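(* Let $p\in(0,1)$ and $q\in(0,1)$. For integers $x\ge1$ let $Y_x$ be the distribution $Y_x(y)=\binom{y-1}{x-1}(1-p)^xp^{y-x}$, $y=x,x+1,\dots$ (the sum of $x$ i.i.d. geometric variables on $\{1,2,\dots\}$ with success probability $1-p$). For integers $y\ge1$ let $$g(y)=\log (y-1)!-\int_0^1\frac{1+t-ty(1-p)-\left(\frac{1-t}{1-pt}\right)^y/(1-t)}{t\log(1-t)}\,dt-\int_0^1\frac{1-typ-\left(\frac{1}{1+pt}\right)^y}{t\log(1-t)}\,dt.$$ Then $\sum_{y=1}^\infty q^y\exp(g(y)-yh(p))<\infty$, so that, with $y_0$ the reciprocal of this sum, $Y^{(q)}(y)=y_0q^y\exp(g(y)-yh(p))$, $y=1,2,\dots$, is a probability distribution; and for all integers $x\ge 1$, $$D_{\mathsf{KL}}(Y_x\|Y^{(q)})=-\log y_0-\mathbb{E}[Y_x]\log q .$$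
   Context: $\log$ is the natural logarithm, $h(p)=-p\log p-(1-p)\log(1-p)$, and $D_{\mathsf{KL}}$ is the Kullback–Leibler divergence (in nats). *)

(* Defs.v *)
From Stdlib Require Import Reals Arith ClassicalEpsilon.
From Coquelicot Require Import Coquelicot.
Open Scope R_scope.

(* A distribution on the positive integers is given by its mass function
   [P : nat -> R]; the value [P 0] is never used, and the sum of [f y] over
   y >= 1 is written [Series (fun k => f (S k))]. *)

Definition is_distribution (P : nat -> R) : Prop :=
  (forall y : nat, (1 <= y)%nat -> 0 <= P y) /\
  is_series (fun k => P (S k)) 1.

Definition expectation (P : nat -> R) : R :=
  Series (fun k => INR (S k) * P (S k)).

Definition abs_continuous (P Q : nat -> R) : Prop :=
  forall y : nat, (1 <= y)%nat -> Q y = 0 -> P y = 0.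

(* The convention 0 log 0 = 0 holds because [ln] is total. *)
Definition KL_term (P Q : nat -> R) (y : nat) : R :=
  P y * ln (P y / Q y).

(* Since u * ln (u / v) >= u - v, the negative parts of the terms are summable
   when P and Q are distributions with P << Q; a divergent series then has
   sum +oo, and a convergent one converges absolutely. *)
Definition KL (P Q : nat -> R) : Rbar :=
  if excluded_middle_informative
       (abs_continuous P Q /\ ex_series (fun k => KL_term P Q (S k)))
  then Finite (Series (fun k => KL_term P Q (S k)))
  else p_infty.

Definition h (p : R) : R := - p * ln p - (1 - p) * ln (1 - p).

(* The guard is needed because [Binomial.C n k] does not vanish for k > n. *)
Definition Ydist (p : R) (x y : nat) : R :=
  if (x <=? y)%nat
  then Binomial.C (y - 1) (x - 1) * (1 - p) ^ x * p ^ (y - x)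
  else 0.

(* For 0 < p < 1 and y >= 1 both integrands are continuous and bounded on the
   open interval (0, 1), so the Riemann integrals exist and do not depend on
   the arbitrary values that total division and [ln] give at t = 0 and t = 1. *)
Definition g (p : R) (y : nat) : R :=
  ln (INR (fact (y - 1)))
  - RInt (fun t =>
      (1 + t - t * INR y * (1 - p) - ((1 - t) / (1 - p * t)) ^ y / (1 - t))
      / (t * ln (1 - t))) 0 1
  - RInt (fun t =>
      (1 - t * INR y * p - (1 / (1 + p * t)) ^ y)
      / (t * ln (1 - t))) 0 1.

Definition weight (p q : R) (y : nat) : R :=
  q ^ y * exp (g p y - INR y * h p).

Definition y0 (p q : R) : R := / Series (fun k => weight p q (S k)).

Definition Yq (p q : R) (y : nat) : R := y0 p q * weight p q y.

(* Main.v *)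
Require Import Defs.
From Stdlib Require Import Reals Arith Lra Lia Psatz ClassicalEpsilon.
From Coquelicot Require Import Coquelicot.
Open Scope R_scope.

(** Since the integral over (0, 1) of (1 - n t - (1 - t)^n) / (t log(1 - t)) is
    log n!, and the probability generating function of Y_x sends
    (1 - t) / (1 - p t) to (1 - t)^x and 1 / (1 + p t) to the value that the
    generating function of Y_x - x takes at 1 - t, averaging the two integrals
    in g over Y_x gives log (x - 1)! and E log (Y_x - x)!.  Hence
    log Y_x(y) - g(y) + y h(p) has mean zero under Y_x, and only the
    normalisation and the factor q^y contribute to the divergence.  The exchange
    of sum and integral is dominated: both integrands are O(y^2) on (0, 1).

    For the summability, (1 + p t)^(-y) >= exp(-p t y) bounds the second integral
    below by log (floor (p y))!, while (1 - t) / (1 - p t) <= (1 - t)^(1 - p)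
    bounds the increment of the first one between y and y + 1 below by
    (1 - p) log((1 - p) y) - O(1/y).  With elementary bounds on factorials this
    gives g(y) <= y h(p) + O(log y) + O(1). *)

(** * Series *)

(** The triangle inequality gives the bound on every finite block after index [n], and the limit in
    the block length preserves it. The bound does not involve [s], which is what makes the
    domination in [is_series_RInt] uniform in [t]. *)
Lemma is_series_tail_le (a B : nat -> R) (s lB : R) (n : nat) :
  (forall k, Rabs (a k) <= B k) -> is_series a s -> is_series B lB ->
  Rabs (s - sum_n a n) <= lB - sum_n B n.
Proof.
  intros Hle Ha HB.
  assert (Hm : forall j, Rabs (sum_n a (j + n) - sum_n a n)
                         <= sum_n B (j + n) - sum_n B n).
  { induction j as [|j IH].
    - simpl; rewrite !Rminus_eq_0, Rabs_R0; lra.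
    - simpl; rewrite !sum_Sn; unfold plus; simpl.
      replace (sum_n a (j + n) + a (S (j + n)) - sum_n a n)
        with ((sum_n a (j + n) - sum_n a n) + a (S (j + n))) by ring.
      apply Rle_trans with (1 := Rabs_triang _ _).
      specialize (Hle (S (j + n))); lra. }
  apply (is_lim_seq_le (fun j => Rabs (sum_n a (j + n) - sum_n a n))
           (fun j => sum_n B (j + n) - sum_n B n)
           (Finite (Rabs (s - sum_n a n))) (Finite (lB - sum_n B n)) Hm).
  - apply (is_lim_seq_abs (fun j => sum_n a (j + n) - sum_n a n)
             (Finite (s - sum_n a n))).
    apply is_lim_seq_minus'; [ | apply is_lim_seq_const].
    apply (is_lim_seq_incr_n (sum_n a) n s); exact Ha.
  - apply is_lim_seq_minus'; [ | apply is_lim_seq_const].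
    apply (is_lim_seq_incr_n (sum_n B) n lB); exact HB.
Qed.

Lemma is_RInt_sum_n (F : nat -> R -> R) (I : nat -> R) (a b : R) (n : nat) :
  (forall k, is_RInt (F k) a b (I k)) ->
  is_RInt (fun t => sum_n (fun k => F k t) n) a b (sum_n I n).
Proof.
  intros HF; induction n as [|n IH].
  - apply is_RInt_ext with (F 0%nat); [intros t _; now rewrite sum_O|].
    rewrite sum_O; apply HF.
  - apply is_RInt_ext with (fun t => plus (sum_n (fun k => F k t) n) (F (S n) t)).
    + intros t _; now rewrite sum_Sn.
    + rewrite sum_Sn; apply (is_RInt_plus (V := R_NormedModule)); auto.
Qed.

(* Coquelicot's limit theorem needs uniform convergence on the whole line, so
   everything is cut off outside the open interval. *)
Lemma is_series_RInt (F : nat -> R -> R) (B I : nat -> R) (S : R -> R) (a b : R) :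
  a < b ->
  (forall k, is_RInt (F k) a b (I k)) ->
  (forall k t, a < t < b -> Rabs (F k t) <= B k) ->
  ex_series B ->
  (forall t, a < t < b -> is_series (fun k => F k t) (S t)) ->
  is_series I (RInt S a b).
Proof.
  intros Hab HI HB [lB HlB] HS.
  pose (cut := fun (f : R -> R) t =>
    if Rlt_dec a t then if Rlt_dec t b then f t else 0 else 0).
  assert (cut_in : forall f t, a < t < b -> cut f t = f t).
  { intros f t [H1 H2]; unfold cut.
    destruct (Rlt_dec a t); [|lra]; destruct (Rlt_dec t b); [reflexivity|lra]. }
  assert (cut_out : forall f t, ~ (a < t < b) -> cut f t = 0).
  { intros f t H; unfold cut.
    destruct (Rlt_dec a t); [|lra]; destruct (Rlt_dec t b); [lra|reflexivity]. }
  destruct (filterlim_RInt (V := R_CompleteNormedModule)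
    (fun n => cut (fun t => sum_n (fun k => F k t) n))
    a b eventually _ (cut S) (fun n => sum_n I n)) as [J [HJ1 HJ2]].
  - intros n; apply is_RInt_ext with (fun t => sum_n (fun k => F k t) n).
    + intros t; rewrite Rmin_left, Rmax_right by lra; intros Ht.
      now rewrite cut_in.
    + now apply is_RInt_sum_n.
  (* Weierstrass M-test: inside the interval the remainder is at most the tail of [B], whatever [t]
     is; outside, both cut-off functions are zero. *)
  - intros P [eps HP].
    destruct (proj2 (is_lim_seq_spec (sum_n B) (Finite lB)) HlB eps) as [N HN].
    exists N; intros n Hn; apply HP; intros t.
    change (Rabs (cut (fun t0 => sum_n (fun k => F k t0) n) t - cut S t) < eps).
    assert (Hdec : a < t < b \/ ~ (a < t < b)) by lra.
    destruct Hdec as [Ht|Ht].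
    + rewrite !cut_in by assumption.
      rewrite Rabs_minus_sym.
      apply Rle_lt_trans with (lB - sum_n B n).
      * apply is_series_tail_le; auto.
      * specialize (HN n Hn); rewrite Rabs_minus_sym in HN.
        apply Rle_lt_trans with (2 := HN), Rle_abs.
    + rewrite !cut_out by assumption; rewrite Rminus_eq_0, Rabs_R0.
      apply cond_pos.
  - replace (RInt S a b) with J; [exact HJ1|].
    symmetry; apply is_RInt_unique, is_RInt_ext with (cut S); [|exact HJ2].
    intros t; rewrite Rmin_left, Rmax_right by lra; intros Ht; now apply cut_in.
Qed.

(** Hockey-stick identity, by iterating Pascal's rule. *)
Lemma C_diag_sum (m k : nat) :
  sum_f_R0 (fun j => Binomial.C (m + j) m) k = Binomial.C (S m + k) (S m).
Proof.
  induction k as [|k IH].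
  - simpl sum_f_R0; rewrite !Nat.add_0_r, !C_n_n; reflexivity.
  - simpl sum_f_R0; rewrite IH.
    replace (S m + S k)%nat with (S (S m + k)) by lia.
    rewrite <- pascal by lia.
    replace (m + S k)%nat with (S m + k)%nat by lia; ring.
Qed.

Lemma C_pos (n k : nat) : 0 < Binomial.C n k.
Proof.
  unfold Binomial.C; apply Rdiv_lt_0_compat;
    [|apply Rmult_lt_0_compat]; apply INR_fact_lt_0.
Qed.

(** Each further factor [/ (1 - u)] is a Cauchy product with the geometric series, whose
    coefficients are the partial sums computed by [C_diag_sum]. *)
Lemma is_series_negbinom (m : nat) (u : R) : 0 <= u < 1 ->
  is_series (fun k => Binomial.C (m + k) m * u ^ k) (/ (1 - u) ^ (S m)).
Proof.
  intros Hu; induction m as [|m IH].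
  - apply is_series_ext with (fun k => u ^ k).
    + intros k; rewrite C_n_0; simpl; ring.
    + simpl; rewrite Rmult_1_r; apply is_series_geom; rewrite Rabs_pos_eq; lra.
  - replace (/ (1 - u) ^ S (S m)) with (/ (1 - u) ^ S m * / (1 - u)).
    2: { simpl; field; split; [|lra].
         apply pow_nonzero; lra. }
    refine (is_series_ext _ _ _ _ (is_series_mult_pos _ (fun k => u ^ k) _ _ IH _ _ _)).
    + intros k; rewrite <- C_diag_sum; rewrite Rmult_comm, scal_sum.
      apply sum_eq; intros i Hi.
      replace (u ^ k) with (u ^ i * u ^ (k - i)); [ring|].
      rewrite <- pow_add; f_equal; lia.
    + apply is_series_geom; rewrite Rabs_pos_eq; lra.
    + intros k; apply Rmult_le_pos; [apply Rlt_le, C_pos | apply pow_le; lra].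
    + intros k; apply pow_le; lra.
Qed.

(** Absorption identity. It trades a factor y for a shift of [m], which reduces moments of the
    negative binomial law to total masses. *)
Lemma C_absorb (m k : nat) :
  INR (S (m + k)) * Binomial.C (m + k) m = INR (S m) * Binomial.C (S m + k) (S m).
Proof.
  unfold Binomial.C.
  replace (m + k - m)%nat with k by lia.
  replace (S m + k - S m)%nat with k by lia.
  replace (S m + k)%nat with (S (m + k)) by lia.
  rewrite !fact_simpl, !mult_INR.
  field; repeat split; try apply INR_fact_neq_0; apply not_0_INR; lia.
Qed.

Lemma is_series_zero_prefix (a : nat -> R) (n : nat) (l : R) :
  (forall k, (k < n)%nat -> a k = 0) ->
  is_series (fun k => a (n + k)%nat) l -> is_series a l.
Proof.
  intros H0 Ha; destruct n as [|n]; [exact Ha|].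
  apply (is_series_decr_n a (S n)); [lia|].
  assert (Hz : sum_n a n = 0).
  { rewrite (sum_n_ext_loc a (fun _ => 0)) by (intros k Hk; apply H0; lia).
    rewrite sum_n_const; apply Rmult_0_r. }
  change (is_series (fun k => a (S n + k)%nat) (l + - sum_n a n)).
  rewrite Hz, Ropp_0, Rplus_0_r; exact Ha.
Qed.

Lemma ex_series_INR_pow (N : nat) (r : R) : 0 < r < 1 ->
  ex_series (fun k => INR (S k) ^ N * r ^ k).
Proof.
  intros Hr.
  assert (Hp : forall k, 0 < INR (S k)) by (intros; apply lt_0_INR; lia).
  apply ex_series_ext with (fun k => Rabs (INR (S k) ^ N * r ^ k)).
  { intros k; apply Rabs_pos_eq, Rmult_le_pos; apply pow_le;
      [apply Rlt_le, Hp | lra]. }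
  apply ex_series_DAlembert with r; [lra| |].
  - intros k; apply Rmult_integral_contrapositive_currified;
      apply pow_nonzero; [apply Rgt_not_eq, Hp | lra].
  - apply is_lim_seq_ext with (fun k => (1 + / INR (S k)) ^ N * r).
    + intros k; rewrite Rabs_pos_eq.
      * replace (1 + / INR (S k)) with (INR (S (S k)) / INR (S k)).
        2: { rewrite (S_INR (S k)); field; apply Rgt_not_eq, Hp. }
        unfold Rdiv at 1; rewrite Rpow_mult_distr, pow_inv; simpl (r ^ S k).
        field; repeat split; try apply pow_nonzero; try lra;
          apply Rgt_not_eq, Hp.
      * apply Rlt_le, Rdiv_lt_0_compat; apply Rmult_lt_0_compat;
          apply pow_lt; try apply Hp; lra.
    + replace (Finite r) with (Finite ((1 + 0) ^ N * r))
        by (rewrite Rplus_0_r, pow1; f_equal; ring).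
      apply is_lim_seq_mult'; [|apply is_lim_seq_const].
      apply (is_lim_seq_continuous (fun x => x ^ N)).
      { apply derivable_continuous_pt, derivable_pt_pow. }
      apply is_lim_seq_plus'; [apply is_lim_seq_const|].
      replace (Finite 0) with (Rbar_inv p_infty) by reflexivity.
      apply is_lim_seq_inv; [|discriminate].
      apply (is_lim_seq_incr_1 INR), is_lim_seq_INR.
Qed.

(** * Elementary bounds on the logarithm *)

Lemma ln_le_sub_1 (x : R) : 0 < x -> ln x <= x - 1.
Proof.
  intros Hx; generalize (exp_ineq1_le (ln x)); rewrite exp_ln by exact Hx; lra.
Qed.

Lemma ln_ge_1_sub_inv (x : R) : 0 < x -> 1 - / x <= ln x.
Proof.
  intros Hx; generalize (ln_le_sub_1 (/ x) (Rinv_0_lt_compat _ Hx)).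
  rewrite ln_Rinv by exact Hx; lra.
Qed.

Lemma ln_1_sub_neg (t : R) : 0 < t < 1 -> ln (1 - t) < 0.
Proof. intros Ht; generalize (ln_le_sub_1 (1 - t)); lra. Qed.

(** * Integrands with denominator t ln(1 - t) *)

(** The continuous extension of [t / ln (1 - t)], with limits -1 at 0 and 0 at 1. Constant values
    outside the interval make continuity at the endpoints two-sided, as integrability from
    continuity demands. *)
Definition phi (t : R) : R :=
  if Rle_dec t 0 then -1 else if Rle_dec 1 t then 0 else t / ln (1 - t).

Lemma phi_in (t : R) : 0 < t < 1 -> phi t = t / ln (1 - t).
Proof.
  intros Ht; unfold phi; destruct (Rle_dec t 0); [lra|].
  destruct (Rle_dec 1 t); [lra|reflexivity].
Qed.

(** Follows from - t / (1 - t) <= ln (1 - t) <= - t. The two bounds meet at [t = 0], which gives the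
    limit there. *)
Lemma phi_bounds (t : R) : 0 < t < 1 -> -1 <= phi t <= - (1 - t).
Proof.
  intros Ht; rewrite phi_in by exact Ht.
  pose proof (ln_1_sub_neg t Ht) as Hn.
  pose proof (ln_le_sub_1 (1 - t) ltac:(lra)) as H1.
  pose proof (ln_ge_1_sub_inv (1 - t) ltac:(lra)) as H2.
  assert (H3 : (1 - t) * (1 - / (1 - t)) = - t) by (field; lra).
  assert (H4 : - t <= (1 - t) * ln (1 - t)).
  { rewrite <- H3; apply Rmult_le_compat_l; lra. }
  assert (E : t / ln (1 - t) * ln (1 - t) = t) by (field; lra).
  split; nra.
Qed.

Lemma Rabs_phi_le_1 (t : R) : 0 < t < 1 -> Rabs (phi t) <= 1.
Proof. intros Ht; apply Rabs_le; generalize (phi_bounds t Ht); lra. Qed.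

Lemma continuous_phi (t : R) : 0 <= t <= 1 -> continuous phi t.
Proof.
  intros Ht; destruct (Req_dec t 0) as [->|H0]; [|destruct (Req_dec t 1) as [->|H1]].
  - apply continuity_pt_filterlim, continuity_pt_locally; intros eps.
    assert (Hd : 0 < Rmin eps 1).
    { apply Rmin_pos; [apply cond_pos|lra]. }
    exists (mkposreal _ Hd); intros u Hu.
    change (Rabs (u - 0) < Rmin eps 1) in Hu.
    rewrite Rminus_0_r in Hu; apply Rabs_lt_between in Hu.
    pose proof (Rmin_l eps 1); pose proof (Rmin_r eps 1).
    assert (phi 0 = -1) as ->.
    { unfold phi; destruct (Rle_dec 0 0); lra. }
    destruct (Rle_dec u 0) as [Hu0|Hu0].
    + replace (phi u) with (-1).
      * rewrite Rminus_eq_0, Rabs_R0; apply cond_pos.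
      * unfold phi; destruct (Rle_dec u 0); lra.
    + pose proof (phi_bounds u ltac:(lra)).
      apply Rabs_lt_between; lra.
  - apply continuity_pt_filterlim, continuity_pt_locally; intros eps.
    pose proof (cond_pos eps) as He.
    (* This radius forces [ln (1 - u) < - / eps] for [u] below 1, hence [Rabs (phi u) < eps]. *)
    assert (Hd : 0 < Rmin (exp (- / eps)) 1).
    { apply Rmin_pos; [apply exp_pos|lra]. }
    exists (mkposreal _ Hd); intros u Hu.
    change (Rabs (u - 1) < Rmin (exp (- / eps)) 1) in Hu.
    apply Rabs_lt_between in Hu.
    pose proof (Rmin_l (exp (- / eps)) 1); pose proof (Rmin_r (exp (- / eps)) 1).
    assert (phi 1 = 0) as ->.
    { unfold phi; destruct (Rle_dec 1 0); [lra|]; destruct (Rle_dec 1 1); lra. }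
    destruct (Rle_dec 1 u) as [Hu0|Hu0].
    + replace (phi u) with 0.
      * rewrite Rminus_eq_0, Rabs_R0; apply He.
      * unfold phi; destruct (Rle_dec u 0); [lra|]; destruct (Rle_dec 1 u); lra.
    + pose proof (phi_bounds u ltac:(lra)) as Hb.
      rewrite phi_in in * by lra.
      assert (Hl : ln (1 - u) < - / eps).
      { rewrite <- (ln_exp (- / eps)); apply ln_increasing; lra. }
      pose proof (ln_1_sub_neg u ltac:(lra)) as Hn.
      assert (E : u / ln (1 - u) * ln (1 - u) = u) by (field; lra).
      assert (E2 : eps * / eps = 1) by (field; lra).
      rewrite Rminus_0_r; apply Rabs_lt_between; split; [|lra].
      apply Rnot_le_lt; intros Hc.
      assert (1 < eps * - ln (1 - u)) by nra.
      nra.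
  - apply continuous_ext_loc with (fun u => u / ln (1 - u)).
    + assert (Hd : 0 < Rmin t (1 - t)) by (apply Rmin_pos; lra).
      exists (mkposreal _ Hd); intros u Hu.
      change (Rabs (u - t) < Rmin t (1 - t)) in Hu.
      apply Rabs_lt_between in Hu.
      pose proof (Rmin_l t (1 - t)); pose proof (Rmin_r t (1 - t)).
      rewrite phi_in by lra; reflexivity.
    + apply (ex_derive_continuous (V := R_NormedModule)).
      auto_derive; split; [|split; [|exact I]]; try lra.
      apply Rlt_not_eq, ln_1_sub_neg; lra.
Qed.

(** The bound is asked only inside the interval, because total division gives the integrands
    meaningless values at 0 and 1. *)
Definition integrable_bounded (F : R -> R) (B : R) : Prop :=
  ex_RInt F 0 1 /\ forall t, 0 < t < 1 -> Rabs (F t) <= B.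

Lemma integrable_bounded_ext (F G : R -> R) (B B' : R) :
  (forall t, 0 < t < 1 -> F t = G t) -> B <= B' ->
  integrable_bounded F B -> integrable_bounded G B'.
Proof.
  intros HFG HB [HF1 HF2]; split.
  - apply ex_RInt_ext with F; [|exact HF1].
    intros t; rewrite Rmin_left, Rmax_right by lra; apply HFG.
  - intros t Ht; rewrite <- HFG by exact Ht.
    apply Rle_trans with (2 := HB), HF2, Ht.
Qed.

Lemma integrable_bounded_plus (F G : R -> R) (B B' : R) :
  integrable_bounded F B -> integrable_bounded G B' ->
  integrable_bounded (fun t => F t + G t) (B + B').
Proof.
  intros [HF1 HF2] [HG1 HG2]; split.
  - apply (ex_RInt_plus (V := R_NormedModule)); assumption.
  - intros t Ht; apply Rle_trans with (1 := Rabs_triang _ _).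
    apply Rplus_le_compat; auto.
Qed.

Lemma integrable_bounded_scal (F : R -> R) (a B : R) :
  integrable_bounded F B ->
  integrable_bounded (fun t => a * F t) (Rabs a * B).
Proof.
  intros [HF1 HF2]; split.
  - apply (ex_RInt_scal (V := R_NormedModule)); assumption.
  - intros t Ht; rewrite Rabs_mult; apply Rmult_le_compat_l; auto using Rabs_pos.
Qed.

Lemma integrable_bounded_mul_phi (M : R -> R) (B : R) :
  (forall t, 0 <= t <= 1 -> continuous M t) ->
  (forall t, 0 < t < 1 -> Rabs (M t) <= B) ->
  integrable_bounded (fun t => M t * phi t) B.
Proof.
  intros HM HB; split.
  - apply (ex_RInt_continuous (V := R_CompleteNormedModule)).
    intros t; rewrite Rmin_left, Rmax_right by lra; intros Ht.
    apply (continuous_mult M phi); [apply HM | apply continuous_phi]; exact Ht.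
  - intros t Ht; rewrite Rabs_mult.
    pose proof (HB t Ht); pose proof (Rabs_phi_le_1 t Ht).
    pose proof (Rabs_pos (M t)); pose proof (Rabs_pos (phi t)); nra.
Qed.

Lemma continuous_pow (w : R -> R) (k : nat) (t : R) :
  continuous w t -> continuous (fun u => w u ^ k) t.
Proof.
  intros Hw; induction k as [|k IH]; [apply continuous_const|].
  apply (continuous_mult w (fun u => w u ^ k)); assumption.
Qed.

Lemma Rabs_pow_le_1 (x : R) (k : nat) : Rabs x <= 1 -> Rabs (x ^ k) <= 1.
Proof.
  intros Hx; rewrite <- RPow_abs; rewrite <- (pow1 k); apply pow_incr.
  split; [apply Rabs_pos | exact Hx].
Qed.

(* The numerator [1 - d w^k] vanishes at [t = 0]; raising [k] adds
   [d w^k (1 - w) = t c d w^k]. *)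
Lemma integrable_bounded_geom (w d e b : R -> R) (K : R) :
  (forall t, 0 <= t <= 1 -> continuous w t /\ continuous e t /\ continuous b t) ->
  (forall t, 0 < t < 1 ->
     Rabs (w t) <= 1 /\ Rabs (e t) <= K /\ Rabs (b t) <= K /\
     d t * (1 - w t) = t * b t /\ d t = 1 + t * e t) ->
  forall k, integrable_bounded (fun t => (1 - d t * w t ^ k) / ln (1 - t))
              (K * (INR k + 1)).
Proof.
  intros Hc Hb; induction k as [|k IH].
  - apply integrable_bounded_ext with (fun t => - e t * phi t) K.
    + intros t Ht; destruct (Hb t Ht) as (_ & _ & _ & _ & ->).
      pose proof (ln_1_sub_neg t Ht).
      rewrite phi_in by exact Ht; simpl; field; lra.
    + simpl; lra.
    + apply (integrable_bounded_mul_phi (fun t => - e t)).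
      * intros t Ht; apply (continuous_opp e), Hc, Ht.
      * intros t Ht; rewrite Rabs_Ropp; apply Hb, Ht.
  - apply integrable_bounded_ext with
      (fun t => (1 - d t * w t ^ k) / ln (1 - t) + (b t * w t ^ k) * phi t)
      (K * (INR k + 1) + K).
    + intros t Ht; destruct (Hb t Ht) as (_ & _ & _ & E & _).
      pose proof (ln_1_sub_neg t Ht).
      rewrite phi_in by exact Ht; simpl.
      replace (1 - d t * (w t * w t ^ k))
        with (1 - d t * w t ^ k + (d t * (1 - w t)) * w t ^ k) by ring.
      rewrite E; field; lra.
    + rewrite S_INR; lra.
    + apply integrable_bounded_plus; [exact IH|].
      apply (integrable_bounded_mul_phi (fun t => b t * w t ^ k)).
      * intros t Ht; apply (continuous_mult b (fun u => w u ^ k));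
          [apply Hc, Ht | apply continuous_pow, Hc, Ht].
      * intros t Ht; destruct (Hb t Ht) as (Hw & _ & Hbt & _).
        rewrite Rabs_mult; pose proof (Rabs_pow_le_1 (w t) k Hw).
        pose proof (Rabs_pos (b t)); pose proof (Rabs_pos (w t ^ k)); nra.
Qed.

(* The numerator [n0 - k a t - s w^k] has a double zero at [t = 0]; raising
   [k] adds [s w^k (1 - w) - a t = - a t (1 - d w^k)]. *)
Lemma integrable_bounded_geom2 (w d e b n0 s m0 : R -> R) (a K : R) :
  0 <= a <= 1 ->
  (forall t, 0 <= t <= 1 -> continuous w t /\ continuous e t /\ continuous b t
                            /\ continuous m0 t) ->
  (forall t, 0 < t < 1 ->
     (Rabs (w t) <= 1 /\ Rabs (e t) <= K /\ Rabs (b t) <= K /\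
     d t * (1 - w t) = t * b t /\ d t = 1 + t * e t) /\
     Rabs (m0 t) <= K /\ n0 t - s t = t ^ 2 * m0 t /\
     s t * (1 - w t) = a * t * d t) ->
  forall k, integrable_bounded
    (fun t => (n0 t - INR k * a * t - s t * w t ^ k) / (t * ln (1 - t)))
    (K * (INR k + 1) ^ 2).
Proof.
  intros Ha Hc Hb; induction k as [|k IH].
  - apply integrable_bounded_ext with (fun t => m0 t * phi t) K.
    + intros t Ht; destruct (Hb t Ht) as (_ & _ & E & _).
      pose proof (ln_1_sub_neg t Ht).
      simpl; rewrite Rmult_0_l, Rmult_0_l, Rmult_1_r, Rminus_0_r, E.
      rewrite phi_in by exact Ht; field; lra.
    + simpl; lra.
    + apply integrable_bounded_mul_phi.
      * intros t Ht; apply Hc, Ht.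
      * intros t Ht; apply Hb, Ht.
  - assert (HK : 0 <= K).
    { destruct (Hb (1/2)) as (_ & H & _); [lra|].
      apply Rle_trans with (2 := H), Rabs_pos. }
    apply integrable_bounded_ext with
      (fun t => (n0 t - INR k * a * t - s t * w t ^ k) / (t * ln (1 - t))
                + (- a) * ((1 - d t * w t ^ k) / ln (1 - t)))
      (K * (INR k + 1) ^ 2 + Rabs (- a) * (K * (INR k + 1))).
    + intros t Ht; destruct (Hb t Ht) as (_ & _ & _ & E).
      pose proof (ln_1_sub_neg t Ht).
      replace (n0 t - INR (S k) * a * t - s t * w t ^ S k) with
        (n0 t - INR k * a * t - s t * w t ^ k - a * t
           + (s t * (1 - w t)) * w t ^ k) by (rewrite S_INR; simpl; ring).
      rewrite E; field; lra.
    + rewrite Rabs_Ropp, Rabs_pos_eq, S_INR by lra; pose proof (pos_INR k).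
      assert (0 <= K * (INR k + 1)) by (apply Rmult_le_pos; lra); nra.
    + apply integrable_bounded_plus; [exact IH|].
      apply integrable_bounded_scal, (integrable_bounded_geom w d e b K).
      * intros t Ht; destruct (Hc t Ht) as (H1 & H2 & H3 & _); auto.
      * intros t Ht; apply Hb, Ht.
Qed.

(** * Integral representation of the logarithm of a factorial *)

Lemma abs_RInt_le_const_open (f : R -> R) (a b M : R) :
  a <= b -> ex_RInt f a b -> (forall t, a < t < b -> Rabs (f t) <= M) ->
  Rabs (RInt f a b) <= M * (b - a).
Proof.
  intros Hab Hf HM.
  assert (Hc : forall c, RInt (fun _ => c) a b = c * (b - a)).
  { intros c; rewrite RInt_const; apply Rmult_comm. }
  apply Rabs_le; split.
  - rewrite Ropp_mult_distr_l, <- Hc; apply RInt_le; auto using ex_RInt_const.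
    intros t Ht; specialize (HM t Ht); apply Rabs_le_between in HM; lra.
  - rewrite <- Hc; apply RInt_le; auto using ex_RInt_const.
    intros t Ht; specialize (HM t Ht); apply Rabs_le_between in HM; lra.
Qed.

(** Replaces limits at the endpoints by explicit linear estimates. If [x] and [y] differed, T = min
    (d, |x - y| / (2 K)) would give |x - y| <= |x - y| / 2. *)
Lemma eq_of_small_diff (x y K d : R) :
  0 < d -> (forall T, 0 < T <= d -> Rabs (x - y) <= K * T) -> x = y.
Proof.
  intros Hd H; destruct (Req_dec x y) as [E|E]; [exact E|exfalso].
  assert (Hp : 0 < Rabs (x - y)) by (apply Rabs_pos_lt; lra).
  assert (HK : 0 < K).
  { specialize (H d ltac:(lra)); apply Rnot_le_lt; intros HK.
    assert (K * d <= 0) by nra; lra. }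
  pose proof (Rmin_l d (Rabs (x - y) / (2 * K))) as H1.
  pose proof (Rmin_r d (Rabs (x - y) / (2 * K))) as H2.
  assert (H3 : 0 < Rmin d (Rabs (x - y) / (2 * K))).
  { apply Rmin_pos; [exact Hd|]; apply Rdiv_lt_0_compat; lra. }
  specialize (H _ (conj H3 H1)).
  assert (K * Rmin d (Rabs (x - y) / (2 * K)) <= K * (Rabs (x - y) / (2 * K)))
    by (apply Rmult_le_compat_l; lra).
  assert (K * (Rabs (x - y) / (2 * K)) = Rabs (x - y) / 2) by (field; lra).
  lra.
Qed.

Lemma ln_neg (v : R) : 0 < v < 1 -> ln v < 0.
Proof. intros Hv; rewrite <- ln_1; apply ln_increasing; lra. Qed.

Lemma continuous_inv_ln (v : R) : 0 < v < 1 -> continuous (fun v => / ln v) v.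
Proof.
  intros Hv; apply (ex_derive_continuous (V := R_NormedModule)); auto_derive.
  split; [lra|split; [|exact I]]; apply Rlt_not_eq, ln_neg, Hv.
Qed.

Lemma ex_RInt_inv_ln (a b : R) : 0 < a < 1 -> 0 < b < 1 ->
  ex_RInt (fun v => / ln v) a b.
Proof.
  intros Ha Hb; apply (ex_RInt_continuous (V := R_CompleteNormedModule)).
  intros v Hv; apply continuous_inv_ln.
  unfold Rmin, Rmax in Hv; destruct (Rle_dec a b); lra.
Qed.

(* [li (1 - t) - li ((1 - t)^(n+1))] is an antiderivative of
   [((1 - t)^n - 1) / ln (1 - t)]; its limits at 0 and 1 are [- ln (n + 1)] and 0. *)
Definition li (x : R) : R := RInt (fun v => / ln v) (1 / 2) x.

Lemma is_derive_li (x : R) : 0 < x < 1 -> is_derive li x (/ ln x).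
Proof.
  intros Hx; apply (is_derive_RInt (fun v => / ln v) li (1 / 2));
    [|apply continuous_inv_ln, Hx].
  assert (Hd : 0 < Rmin x (1 - x)) by (apply Rmin_pos; lra).
  exists (mkposreal _ Hd); intros u Hu.
  change (Rabs (u - x) < Rmin x (1 - x)) in Hu; apply Rabs_lt_between in Hu.
  pose proof (Rmin_l x (1 - x)); pose proof (Rmin_r x (1 - x)).
  apply (RInt_correct (V := R_CompleteNormedModule)), ex_RInt_inv_ln; lra.
Qed.

Lemma li_sub (a b : R) : 0 < a < 1 -> 0 < b < 1 ->
  li b - li a = RInt (fun v => / ln v) a b.
Proof.
  intros Ha Hb; unfold li.
  rewrite <- (RInt_Chasles (V := R_CompleteNormedModule) (fun v => / ln v) (1/2) a b)
    by (apply ex_RInt_inv_ln; lra).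
  unfold plus; simpl; ring.
Qed.

Lemma pow_S_in (x : R) (n : nat) : 0 < x < 1 -> 0 < x ^ S n <= x.
Proof.
  intros Hx; split; [apply pow_lt; lra|].
  simpl; rewrite <- (Rmult_1_r x) at 3; apply Rmult_le_compat_l; [lra|].
  rewrite <- (pow1 n); apply pow_incr; lra.
Qed.

Lemma ln_pow (x : R) (n : nat) : 0 < x -> ln (x ^ n) = INR n * ln x.
Proof.
  intros Hx; rewrite <- Rpower_pow by exact Hx; apply ln_exp.
Qed.

(** Below [exp (-1)] the integrand [/ ln v] has absolute value at most 1, and the interval of
    integration is no longer than [x]. *)
Lemma li_sub_pow_near_0 (x : R) (n : nat) : 0 < x <= exp (-1) ->
  Rabs (li x - li (x ^ S n)) <= x.
Proof.
  intros Hx; assert (Hx1 : x < 1).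
  { apply Rle_lt_trans with (1 := proj2 Hx); rewrite <- exp_0.
    apply exp_increasing; lra. }
  destruct (pow_S_in x n) as [H1 H2]; [lra|].
  rewrite li_sub by lra.
  apply Rle_trans with (1 * (x - x ^ S n)); [|lra].
  apply abs_RInt_le_const_open; [exact H2|apply ex_RInt_inv_ln; lra|].
  intros v Hv.
  assert (Hl : ln v <= -1).
  { rewrite <- (ln_exp (-1)); apply ln_le; lra. }
  rewrite Rabs_inv, Rabs_left by lra.
  rewrite <- Rinv_1; apply Rinv_le_contravar; lra.
Qed.

Lemma is_RInt_inv_ln_weighted (x : R) (n : nat) : 0 < x < 1 ->
  is_RInt (fun v => / (v * ln v)) (x ^ S n) x (- ln (INR (S n))).
Proof.
  intros Hx; destruct (pow_S_in x n Hx) as [H1 H2].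
  replace (- ln (INR (S n))) with (ln (- ln x) - ln (- ln (x ^ S n))).
  - apply (is_RInt_derive (V := R_CompleteNormedModule) (fun v => ln (- ln v))).
    + intros v; rewrite Rmin_left, Rmax_right by lra; intros Hv.
      pose proof (ln_neg v ltac:(lra)).
      auto_derive; [split; [lra|split; [lra|exact I]]|field; lra].
    + intros v; rewrite Rmin_left, Rmax_right by lra; intros Hv.
      pose proof (ln_neg v ltac:(lra)).
      apply (ex_derive_continuous (V := R_NormedModule)); auto_derive.
      split; [lra|split; [nra|exact I]].
  - pose proof (ln_neg x Hx); rewrite ln_pow by lra.
    replace (- (INR (S n) * ln x)) with (INR (S n) * - ln x) by ring.
    rewrite ln_mult; [ring| |lra].
    apply lt_0_INR; lia.
Qed.

Lemma is_RInt_inv (a b : R) : 0 < a <= b ->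
  is_RInt (fun v => / v) a b (ln b - ln a).
Proof.
  intros Ha; apply (is_RInt_derive (V := R_CompleteNormedModule) ln).
  - intros v; rewrite Rmin_left, Rmax_right by lra; intros Hv.
    auto_derive; [lra|field; lra].
  - intros v; rewrite Rmin_left, Rmax_right by lra; intros Hv.
    apply (ex_derive_continuous (V := R_NormedModule)); auto_derive; lra.
Qed.

(* [1 / ln v] and [1 / (v ln v)] differ by at most [1 / v], and the latter has
   the antiderivative [ln (- ln v)]. *)
Lemma li_sub_pow_near_1 (x : R) (n : nat) : 0 < x < 1 ->
  Rabs (li x - li (x ^ S n) + ln (INR (S n))) <= - INR n * ln x.
Proof.
  intros Hx; destruct (pow_S_in x n Hx) as [H1 H2].
  rewrite li_sub by lra.
  assert (HL := RInt_correct (V := R_CompleteNormedModule) _ _ _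
                  (ex_RInt_inv_ln (x ^ S n) x ltac:(lra) ltac:(lra))).
  assert (HW := is_RInt_inv_ln_weighted x n Hx).
  assert (HI := is_RInt_inv (x ^ S n) x (conj H1 H2)).
  assert (Hs := is_RInt_plus (V := R_NormedModule) _ _ _ _ _ _ HW HI).
  rewrite ln_pow in HI, Hs by lra.
  assert (Hv : forall v, x ^ S n < v < x ->
    / (v * ln v) <= / ln v <= / (v * ln v) + / v).
  { intros v Hv; pose proof (ln_neg v ltac:(lra)).
    pose proof (ln_le_sub_1 v ltac:(lra)).
    pose proof (Rinv_0_lt_compat v ltac:(lra)).
    (* The extra term is nonnegative, and [1 - v <= - ln v] bounds it by [/ v]. *)
    assert (E1 : / ln v = / (v * ln v) + (1 - v) * (/ v * / (- ln v)))
      by (field; lra).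
    assert (E2 : / v = (- ln v) * (/ v * / (- ln v))) by (field; lra).
    assert (0 < / (- ln v)) by (apply Rinv_0_lt_compat; lra).
    assert (0 < / v * / (- ln v)) by (apply Rmult_lt_0_compat; lra).
    split; [rewrite E1; nra|].
    rewrite E1; apply Rplus_le_compat_l; rewrite E2 at 2.
    apply Rmult_le_compat_r; lra. }
  assert (Hlow := is_RInt_le _ _ _ _ _ _ H2 HW HL (fun v h => proj1 (Hv v h))).
  assert (Hup := is_RInt_le _ _ _ _ _ _ H2 HL Hs (fun v h => proj2 (Hv v h))).
  change (RInt (fun v => / ln v) (x ^ S n) x
    <= - ln (INR (S n)) + (ln x - INR (S n) * ln x)) in Hup.
  pose proof (S_INR n) as HS; apply Rabs_le; split; [|nra].
  assert (INR n * ln x <= 0); [|lra].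
  pose proof (pos_INR n); pose proof (ln_neg x Hx); nra.
Qed.

Lemma integrable_bounded_ln_integrand (n : nat) :
  integrable_bounded (fun t => ((1 - t) ^ n - 1) / ln (1 - t)) (INR n + 1).
Proof.
  apply integrable_bounded_ext with
    (fun t => (-1) * ((1 - 1 * (1 - t) ^ n) / ln (1 - t)))
    (Rabs (-1) * (1 * (INR n + 1))).
  - intros t Ht; pose proof (ln_1_sub_neg t Ht); field; lra.
  - rewrite Rabs_left; lra.
  - apply integrable_bounded_scal.
    apply (integrable_bounded_geom (fun t => 1 - t) (fun _ => 1) (fun _ => 0)
             (fun _ => 1) 1).
    + intros t _; split; [|split; apply continuous_const].
      apply (ex_derive_continuous (V := R_NormedModule)); auto_derive; exact I.
    + intros t Ht; rewrite Rabs_R0, Rabs_R1, Rabs_pos_eq by lra.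
      repeat split; lra.
Qed.

(** In the chain rule the factor [INR (S n)] from the power cancels the one in
    [ln ((1 - t) ^ S n)]. *)
Lemma is_derive_li_sub_pow (n : nat) (t : R) : 0 < t < 1 ->
  is_derive (fun t => li (1 - t) - li ((1 - t) ^ S n)) t
    (((1 - t) ^ n - 1) / ln (1 - t)).
Proof.
  intros Ht; pose proof (ln_1_sub_neg t Ht) as Hl.
  destruct (pow_S_in (1 - t) n) as [H1 H2]; [lra|].
  assert (D1 := is_derive_li (1 - t) ltac:(lra)).
  assert (D2 := is_derive_li ((1 - t) ^ S n) ltac:(lra)).
  assert (E1 : is_derive (fun t => 1 - t) t (-1)) by (auto_derive; [exact I|ring]).
  assert (E2 : is_derive (fun t => (1 - t) ^ S n) t (- (INR (S n) * (1 - t) ^ n))).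
  { evar_last; [apply is_derive_pow, E1|].
    change (Init.Nat.pred (S n)) with n; ring. }
  assert (F := is_derive_minus (V := R_NormedModule) _ _ _ _ _
     (is_derive_comp li _ _ _ _ D1 E1)
     (is_derive_comp li _ _ _ _ D2 E2)).
  assert (E : -1 * / ln (1 - t)
     - (- (INR (S n) * (1 - t) ^ n)) * / ln ((1 - t) ^ S n)
     = ((1 - t) ^ n - 1) / ln (1 - t)).
  { rewrite ln_pow by lra; field; split; [lra|apply not_0_INR; lia]. }
  rewrite <- E; exact F.
Qed.

(** The integral from 0 to T minus the antiderivative built from [li] has derivative zero, so it is
    a constant. Letting T tend to 0 identifies the constant as [ln (INR (S n))]; letting T tend to 1
    identifies it as the whole integral. *)
Lemma is_RInt_ln_S (n : nat) :
  is_RInt (fun t => ((1 - t) ^ n - 1) / ln (1 - t)) 0 1 (ln (INR (S n))).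
Proof.
  set (k := fun t => ((1 - t) ^ n - 1) / ln (1 - t)).
  destruct (integrable_bounded_ln_integrand n) as [Hk Hb]; fold k in Hk, Hb.
  assert (Hkx : forall a b, 0 <= a -> a <= b -> b <= 1 -> ex_RInt k a b).
  { intros a b H1 H2 H3; apply (ex_RInt_Chasles_1 (V := R_CompleteNormedModule)) with 1; [lra|].
    apply (ex_RInt_Chasles_2 (V := R_CompleteNormedModule)) with 0; [lra|exact Hk]. }
  pose (G := fun T => RInt k 0 T - (li (1 - T) - li ((1 - T) ^ S n))).
  assert (HG : forall t, 0 < t < 1 -> is_derive G t zero).
  { intros t Ht.
    assert (D1 : is_derive (fun T => RInt k 0 T) t (k t)).
    { apply (is_derive_RInt k _ 0).
      - assert (Hd : 0 < Rmin t (1 - t)) by (apply Rmin_pos; lra).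
        exists (mkposreal _ Hd); intros u Hu.
        change (Rabs (u - t) < Rmin t (1 - t)) in Hu; apply Rabs_lt_between in Hu.
        pose proof (Rmin_l t (1 - t)); pose proof (Rmin_r t (1 - t)).
        apply (RInt_correct (V := R_CompleteNormedModule)), Hkx; lra.
      - pose proof (ln_1_sub_neg t Ht).
        apply (ex_derive_continuous (V := R_NormedModule)).
        unfold k; auto_derive; split; [lra|split; [|exact I]].
        apply Rlt_not_eq, ln_1_sub_neg, Ht. }
    assert (D := is_derive_minus (V := R_NormedModule) _ _ _ _ _ D1
                   (is_derive_li_sub_pow n t Ht)).
    unfold k in D at 2; rewrite minus_eq_zero in D; exact D. }
  assert (Hconst : forall T, 0 < T < 1 -> G T = G (1 / 2)).
  { intros T HT; destruct (Rtotal_order T (1/2)) as [H|[->|H]]; [|reflexivity|];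
      [|symmetry]; (apply (eq_is_derive (V := R_NormedModule)); [|exact H]);
      intros u Hu; apply HG; lra. }
  assert (Hc : G (1 / 2) = ln (INR (S n))).
  (* [INR n + 1] bounds the integrand; [2 * INR n] comes from [- ln (1 - T) <= 2 * T], valid for
     [T <= 1 / 2]. *)
  { apply eq_of_small_diff with (K := INR n + 1 + 2 * INR n) (d := 1 / 2); [lra|].
    intros T HT; rewrite <- (Hconst T) by lra.
    replace (G T - ln (INR (S n))) with
      (RInt k 0 T + - (li (1 - T) - li ((1 - T) ^ S n) + ln (INR (S n))))
      by (unfold G; ring).
    apply Rle_trans with (1 := Rabs_triang _ _); rewrite Rabs_Ropp.
    assert (B1 : Rabs (RInt k 0 T) <= (INR n + 1) * (T - 0)).
    { apply abs_RInt_le_const_open; [lra|apply Hkx; lra|].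
      intros t Ht; apply Hb; lra. }
    pose proof (li_sub_pow_near_1 (1 - T) n ltac:(lra)) as B2.
    assert (B3 : - ln (1 - T) <= 2 * T).
    { pose proof (ln_ge_1_sub_inv (1 - T) ltac:(lra)) as H.
      assert (/ (1 - T) * (1 - T) = 1) by (field; lra).
      assert (0 < / (1 - T)) by (apply Rinv_0_lt_compat; lra).
      assert (/ (1 - T) <= 1 + 2 * T); [|lra].
      nra. }
    pose proof (pos_INR n).
    assert (- INR n * ln (1 - T) <= INR n * (2 * T)) by nra.
    lra. }
  replace (ln (INR (S n))) with (RInt k 0 1);
    [apply (RInt_correct (V := R_CompleteNormedModule)), Hk|].
  rewrite <- Hc.
  assert (He : 0 < exp (-1) < 1).
  { split; [apply exp_pos|]; rewrite <- exp_0; apply exp_increasing; lra. }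
  (* Now T is the distance to the endpoint 1, restricted to the range of [li_sub_pow_near_0], which
     contributes the last 1. *)
  apply eq_of_small_diff with (K := INR n + 1 + 1) (d := exp (-1)); [lra|].
  intros T HT; rewrite <- (Hconst (1 - T)) by lra.
  assert (HC : RInt k 0 (1 - T) + RInt k (1 - T) 1 = RInt k 0 1).
  { apply (RInt_Chasles (V := R_CompleteNormedModule)); apply Hkx; lra. }
  replace (RInt k 0 1 - G (1 - T)) with (RInt k (1 - T) 1 + (li T - li (T ^ S n))).
  2: { unfold G; replace (1 - (1 - T)) with T by ring; lra. }
  apply Rle_trans with (1 := Rabs_triang _ _).
  assert (B1 : Rabs (RInt k (1 - T) 1) <= (INR n + 1) * (1 - (1 - T))).
  { apply abs_RInt_le_const_open; [lra|apply Hkx; lra|].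
    intros t Ht; apply Hb; lra. }
  pose proof (li_sub_pow_near_0 T n ltac:(lra)); lra.
Qed.

(** Raising [n] by one adds [t * ((1 - t) ^ n - 1)] to the numerator, so the integral grows by
    [ln (INR (S n))]. *)
Lemma is_RInt_ln_fact (n : nat) :
  is_RInt (fun t => (1 - INR n * t - (1 - t) ^ n) / (t * ln (1 - t))) 0 1
    (ln (INR (fact n))).
Proof.
  induction n as [|n IH].
  - simpl fact; simpl INR; rewrite ln_1.
    apply is_RInt_ext with (fun _ => 0).
    + intros t; rewrite Rmin_left, Rmax_right by lra; intros Ht.
      pose proof (ln_1_sub_neg t Ht); simpl; field; lra.
    + refine (eq_ind _ (is_RInt _ 0 1) (is_RInt_const (V := R_NormedModule) 0 1 0) 0 _).
      apply Rmult_0_r.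
  - rewrite fact_simpl, mult_INR, Rmult_comm, ln_mult;
      [|apply INR_fact_lt_0|apply lt_0_INR; lia].
    eapply is_RInt_ext;
      [|apply (is_RInt_plus (V := R_NormedModule) _ _ _ _ _ _ IH (is_RInt_ln_S n))].
    intros t; rewrite Rmin_left, Rmax_right by lra; intros Ht.
    pose proof (ln_1_sub_neg t Ht).
    unfold plus; simpl plus; rewrite S_INR; simpl; field; lra.
Qed.

(** * The integrands of [g]: integrability and quadratic bounds *)

Definition integrand1 (p : R) (y : nat) (t : R) : R :=
  (1 + t - t * INR y * (1 - p) - ((1 - t) / (1 - p * t)) ^ y / (1 - t))
  / (t * ln (1 - t)).

Definition integrand2 (p : R) (y : nat) (t : R) : R :=
  (1 - t * INR y * p - (1 / (1 + p * t)) ^ y) / (t * ln (1 - t)).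

Definition integrand_ln_fact (n : nat) (t : R) : R :=
  (1 - INR n * t - (1 - t) ^ n) / (t * ln (1 - t)).

Lemma inv_1_sub_bounds (p t : R) : 0 < p < 1 -> 0 <= t <= 1 ->
  1 <= / (1 - p * t) <= / (1 - p).
Proof.
  intros Hp Ht; split.
  - rewrite <- Rinv_1; apply Rinv_le_contravar; nra.
  - apply Rinv_le_contravar; nra.
Qed.

Lemma inv_1_add_bounds (p t : R) : 0 < p < 1 -> 0 <= t <= 1 ->
  0 < / (1 + p * t) <= 1.
Proof.
  intros Hp Ht; split; [apply Rinv_0_lt_compat; nra|].
  rewrite <- Rinv_1; apply Rinv_le_contravar; nra.
Qed.

(** For y = k + 1 one factor of the power cancels [1 - t], leaving the form of
    [integrable_bounded_geom2] with [a = 1 - p] and s = 1 / (1 - p t). The cube in the bound comes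
    from [b], which is (1 - p) / (1 - p t)^3. *)
Lemma integrable_bounded_integrand1 (p : R) (k : nat) : 0 < p < 1 ->
  integrable_bounded (integrand1 p (S k)) (2 / (1 - p) ^ 3 * (INR k + 1) ^ 2).
Proof.
  intros Hp.
  apply integrable_bounded_ext with
    (fun t => ((1 + p * t) - INR k * (1 - p) * t
       - / (1 - p * t) * ((1 - t) / (1 - p * t)) ^ k) / (t * ln (1 - t)))
    (2 / (1 - p) ^ 3 * (INR k + 1) ^ 2); [|lra|].
  - intros t Ht; pose proof (ln_1_sub_neg t Ht).
    assert (1 - p * t <> 0) by nra.
    unfold integrand1; rewrite S_INR; simpl; field; repeat split; lra.
  - assert (HK : 1 <= / (1 - p)).
    { rewrite <- Rinv_1; apply Rinv_le_contravar; lra. }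
    replace (2 / (1 - p) ^ 3) with (2 * / (1 - p) ^ 3) by reflexivity.
    rewrite <- pow_inv.
    apply (integrable_bounded_geom2
      (fun t => (1 - t) / (1 - p * t)) (fun t => / (1 - p * t) ^ 2)
      (fun t => (2 * p - p ^ 2 * t) * / (1 - p * t) ^ 2)
      (fun t => (1 - p) * / (1 - p * t) ^ 3) _ _
      (fun t => - p ^ 2 * / (1 - p * t))); [lra| |].
    + intros t Ht; assert (1 - p * t <> 0) by nra.
      assert (1 + - (p * t) <> 0) by lra.
      repeat split; apply (ex_derive_continuous (V := R_NormedModule));
        auto_derive; repeat split; repeat apply Rmult_integral_contrapositive_currified;
        auto using R1_neq_R0.
    + intros t Ht; assert (1 - p * t <> 0) by nra.
      pose proof (inv_1_sub_bounds p t Hp ltac:(lra)) as Hi.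
      unfold Rdiv; rewrite <- !pow_inv.
      set (i := / (1 - p * t)) in *; set (J := / (1 - p)) in *.
      assert (Ei : (1 - p * t) * i = 1) by (unfold i; field; lra).
      assert (H2 : i ^ 2 <= J ^ 2) by (apply pow_incr; lra).
      assert (H3 : i ^ 3 <= J ^ 3) by (apply pow_incr; lra).
      assert (P2 : 1 <= i ^ 2) by (apply pow_R1_Rle; lra).
      assert (P3 : 1 <= i ^ 3) by (apply pow_R1_Rle; lra).
      assert (J2 : J ^ 2 <= J ^ 3).
      { simpl; rewrite !Rmult_1_r.
        rewrite <- (Rmult_1_l (J * J)) at 1; apply Rmult_le_compat_r; nra. }
      assert (J1 : J <= J ^ 2) by (simpl; nra).
      repeat split.
      * rewrite Rabs_pos_eq; nra.
      * rewrite Rabs_pos_eq by nra.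
        apply Rle_trans with (2 * i ^ 2); [|lra].
        apply Rmult_le_compat_r; nra.
      * rewrite Rabs_pos_eq by nra.
        apply Rle_trans with (1 * i ^ 3); [|lra].
        apply Rmult_le_compat_r; lra.
      * unfold i; field; lra.
      * unfold i; field; lra.
      * rewrite <- Ropp_mult_distr_l, Rabs_Ropp, Rabs_pos_eq by nra.
        apply Rle_trans with (1 * i); [|lra].
        apply Rmult_le_compat_r; nra.
      * unfold i; field; lra.
      * unfold i; field; lra.
Qed.

Lemma integrable_bounded_integrand2 (p : R) (k : nat) : 0 < p < 1 ->
  integrable_bounded (integrand2 p k) (1 * (INR k + 1) ^ 2).
Proof.
  intros Hp.
  apply integrable_bounded_ext with
    (fun t => (1 - INR k * p * t - 1 * (/ (1 + p * t)) ^ k) / (t * ln (1 - t)))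
    (1 * (INR k + 1) ^ 2); [|lra|].
  - intros t Ht; unfold integrand2, Rdiv; rewrite !Rmult_1_l; f_equal; ring.
  - apply (integrable_bounded_geom2
      (fun t => / (1 + p * t)) (fun t => / (1 + p * t))
      (fun t => - p * / (1 + p * t))
      (fun t => p * / (1 + p * t) ^ 2) _ _ (fun _ => 0)); [lra| |].
    + intros t Ht; assert (1 + p * t <> 0) by nra.
      repeat split; apply (ex_derive_continuous (V := R_NormedModule));
        auto_derive; repeat split; repeat apply Rmult_integral_contrapositive_currified;
        auto using R1_neq_R0.
    + intros t Ht; assert (1 + p * t <> 0) by nra.
      pose proof (inv_1_add_bounds p t Hp ltac:(lra)) as Hi.
      rewrite <- !pow_inv, Rabs_R0.
      set (i := / (1 + p * t)) in *.
      assert (i ^ 2 <= 1) by (rewrite <- (pow1 2); apply pow_incr; lra).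
      assert (0 <= i ^ 2) by (apply pow_le; lra).
      repeat split; try lra.
      * rewrite Rabs_pos_eq; lra.
      * rewrite <- Ropp_mult_distr_l, Rabs_Ropp, Rabs_pos_eq; nra.
      * rewrite Rabs_pos_eq; nra.
      * unfold i; field; lra.
      * unfold i; field; lra.
      * unfold i; field; lra.
Qed.

Lemma integrable_bounded_integrand_ln_fact (n : nat) :
  integrable_bounded (integrand_ln_fact n) (1 * (INR n + 1) ^ 2).
Proof.
  apply integrable_bounded_ext with
    (fun t => (1 - INR n * 1 * t - 1 * (1 - t) ^ n) / (t * ln (1 - t)))
    (1 * (INR n + 1) ^ 2); [|lra|].
  - intros t Ht; unfold integrand_ln_fact; f_equal; ring.
  - apply (integrable_bounded_geom2 (fun t => 1 - t) (fun _ => 1) (fun _ => 0)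
      (fun _ => 1) (fun _ => 1) (fun _ => 1) (fun _ => 0)); [lra| |].
    + intros t Ht; repeat split; apply (ex_derive_continuous (V := R_NormedModule));
        auto_derive; exact I.
    + intros t Ht; rewrite Rabs_R0, Rabs_R1, Rabs_pos_eq by lra.
      repeat split; lra.
Qed.

(** * Averages over the negative binomial distribution *)

(** The law of Y_x - x for x = m + 1, with j = y - x. This indexing avoids truncated subtraction and
    the guard in [Ydist]. *)
Definition negbinom (p : R) (m j : nat) : R :=
  Binomial.C (m + j) m * (1 - p) ^ S m * p ^ j.

Lemma Ydist_negbinom (p : R) (m j : nat) :
  Ydist p (S m) (S (m + j)) = negbinom p m j.
Proof.
  unfold Ydist, negbinom.
  replace (S m <=? S (m + j))%nat with true by (symmetry; apply Nat.leb_le; lia).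
  replace (S (m + j) - 1)%nat with (m + j)%nat by lia.
  replace (S m - 1)%nat with m by lia.
  replace (S (m + j) - S m)%nat with j by lia; reflexivity.
Qed.

Lemma Ydist_lt (p : R) (x y : nat) : (y < x)%nat -> Ydist p x y = 0.
Proof.
  intros H; unfold Ydist.
  replace (x <=? y)%nat with false by (symmetry; apply Nat.leb_gt; lia).
  reflexivity.
Qed.

Lemma negbinom_pos (p : R) (m j : nat) : 0 < p < 1 -> 0 < negbinom p m j.
Proof.
  intros Hp; unfold negbinom.
  apply Rmult_lt_0_compat; [apply Rmult_lt_0_compat; [apply C_pos|]|];
    apply pow_lt; lra.
Qed.

(* [is_series_ext] at type [R], where [ring] and [field] recognise equality. *)
Lemma is_series_eq (a b : nat -> R) (l : R) :
  (forall k, a k = b k) -> is_series a l -> is_series b l.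
Proof. exact (is_series_ext (V := R_NormedModule) a b l). Qed.

Lemma is_series_lin (a : nat -> R) (c l : R) :
  is_series a l -> is_series (fun k => c * a k) (c * l).
Proof. exact (is_series_scal (V := R_NormedModule) c a l). Qed.

Lemma is_series_add (a b : nat -> R) (la lb : R) :
  is_series a la -> is_series b lb -> is_series (fun k => a k + b k) (la + lb).
Proof. exact (is_series_plus (V := R_NormedModule) a b la lb). Qed.

Lemma negbinom_pgf (p v : R) (m : nat) : 0 < p < 1 -> 0 <= v <= 1 ->
  is_series (fun j => negbinom p m j * v ^ j) (((1 - p) / (1 - p * v)) ^ S m).
Proof.
  intros Hp Hv; assert (Hu : 0 <= p * v < 1) by nra.
  replace (((1 - p) / (1 - p * v)) ^ S m)
    with ((1 - p) ^ S m * / (1 - p * v) ^ S m)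
    by (unfold Rdiv; rewrite Rpow_mult_distr, pow_inv; reflexivity).
  eapply is_series_eq; [|apply is_series_lin, (is_series_negbinom m _ Hu)].
  intros j; unfold negbinom; rewrite Rpow_mult_distr; ring.
Qed.

Lemma negbinom_total (p : R) (m : nat) : 0 < p < 1 ->
  is_series (negbinom p m) 1.
Proof.
  intros Hp; replace 1 with (((1 - p) / (1 - p * 1)) ^ S m).
  - eapply is_series_eq; [|apply negbinom_pgf; lra].
    intros j; simpl; rewrite pow1; ring.
  - replace ((1 - p) / (1 - p * 1)) with 1 by (field; lra); apply pow1.
Qed.

(** Size-biasing: weighting the law by y gives, up to the mean, the law with [m] raised by one at
    the same [j]. The mean and the second moment follow from the total mass. *)
Lemma negbinom_mul_index (p : R) (m j : nat) : 0 < p < 1 ->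
  INR (S (m + j)) * negbinom p m j = INR (S m) / (1 - p) * negbinom p (S m) j.
Proof.
  intros Hp; unfold negbinom.
  replace (INR (S (m + j)) * (Binomial.C (m + j) m * (1 - p) ^ S m * p ^ j))
    with ((INR (S (m + j)) * Binomial.C (m + j) m) * (1 - p) ^ S m * p ^ j) by ring.
  rewrite C_absorb; simpl (_ ^ S (S m)); simpl (_ ^ S m); field; lra.
Qed.

Lemma negbinom_mean (p : R) (m : nat) : 0 < p < 1 ->
  is_series (fun j => INR (S (m + j)) * negbinom p m j) (INR (S m) / (1 - p)).
Proof.
  intros Hp; rewrite <- (Rmult_1_r (INR (S m) / (1 - p))).
  eapply is_series_eq; [|apply is_series_lin, (negbinom_total p (S m) Hp)].
  intros j; rewrite negbinom_mul_index by exact Hp; reflexivity.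
Qed.

(** The rising product y (y + 1) suits two uses of [negbinom_mul_index] and dominates the quadratic
    bounds on the integrands. *)
Lemma negbinom_second_moment (p : R) (m : nat) : 0 < p < 1 ->
  ex_series (fun j => INR (S (S (m + j))) * (INR (S (m + j)) * negbinom p m j)).
Proof.
  intros Hp; exists (INR (S m) / (1 - p) * (INR (S (S m)) / (1 - p))).
  eapply is_series_eq; [|apply is_series_lin, (negbinom_mean p (S m) Hp)].
  intros j; rewrite (negbinom_mul_index p m j) by exact Hp.
  replace (S m + j)%nat with (S (m + j)) by lia; ring.
Qed.

Lemma negbinom_integrand1 (p : R) (m : nat) : 0 < p < 1 ->
  is_series (fun j => negbinom p m j * RInt (integrand1 p (S (m + j))) 0 1)
    (ln (INR (fact m))).
Proof.
  intros Hp.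
  rewrite <- (is_RInt_unique _ _ _ _ (is_RInt_ln_fact m)).
  apply is_series_RInt with
    (F := fun j t => negbinom p m j * integrand1 p (S (m + j)) t)
    (B := fun j => 2 / (1 - p) ^ 3 *
            (INR (S (S (m + j))) * (INR (S (m + j)) * negbinom p m j))).
  - lra.
  - intros j; apply (is_RInt_scal (V := R_NormedModule)).
    apply (RInt_correct (V := R_CompleteNormedModule)).
    apply (integrable_bounded_integrand1 p (m + j) Hp).
  - intros j t Ht; pose proof (negbinom_pos p m j Hp).
    rewrite Rabs_mult, (Rabs_pos_eq (negbinom p m j)) by lra.
    destruct (integrable_bounded_integrand1 p (m + j) Hp) as [_ Hb].
    specialize (Hb t Ht); rewrite <- S_INR in Hb.
    assert (HK : 0 < 2 / (1 - p) ^ 3)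
      by (apply Rdiv_lt_0_compat; [lra|apply pow_lt; lra]).
    apply Rle_trans with (negbinom p m j * (2 / (1 - p) ^ 3 * INR (S (m + j)) ^ 2)).
    { apply Rmult_le_compat_l; lra. }
    replace (2 / (1 - p) ^ 3 * (INR (S (S (m + j))) * (INR (S (m + j)) * negbinom p m j)))
      with (negbinom p m j * (2 / (1 - p) ^ 3 * (INR (S (S (m + j))) * INR (S (m + j)))))
      by ring.
    apply Rmult_le_compat_l; [lra|]; apply Rmult_le_compat_l; [lra|].
    rewrite (S_INR (S (m + j))); pose proof (pos_INR (S (m + j))); nra.
  - apply (ex_series_scal (V := R_NormedModule)), negbinom_second_moment, Hp.
  - intros t Ht; pose proof (ln_1_sub_neg t Ht) as Hl.
    assert (Hpt : 0 < 1 - p * t) by nra.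
    set (z := (1 - t) / (1 - p * t)).
    assert (Hz : 0 <= z <= 1).
    { unfold z; split; [apply Rdiv_le_0_compat; lra|].
      apply Rmult_le_reg_r with (1 - p * t); [lra|].
      unfold Rdiv; rewrite Rmult_assoc, Rinv_l by lra; nra. }
    (* The generating function of Y_x at [z] is the x-th power of this left-hand side; the division
       by [1 - t] then leaves [(1 - t) ^ m]. *)
    assert (Hz1 : z * ((1 - p) / (1 - p * z)) = 1 - t).
    { unfold z; field; split; [lra|].
      apply Rgt_not_eq; nra. }
    set (D := t * ln (1 - t)).
    assert (HD : D <> 0) by (apply Rmult_integral_contrapositive_currified; lra).
    (* The integrand is a constant, plus a multiple of y, plus a multiple of z^y. These average
       through the total mass, the mean and the generating function. *)
    assert (S1 := is_series_lin _ ((1 + t) / D) _ (negbinom_total p m Hp)).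
    assert (S2 := is_series_lin _ (- (t * (1 - p)) / D) _ (negbinom_mean p m Hp)).
    assert (S3 := is_series_lin _ (- z ^ S m / ((1 - t) * D)) _ (negbinom_pgf p z m Hp Hz)).
    assert (S123 := is_series_add _ _ _ _ (is_series_add _ _ _ _ S1 S2) S3).
    match type of S123 with is_series _ ?l =>
      replace ((1 - INR m * t - (1 - t) ^ m) / D) with l end.
    + eapply is_series_eq; [|exact S123].
      intros j; unfold integrand1; fold z D.
      replace (S (m + j)) with (S m + j)%nat by lia.
      rewrite (pow_add z (S m) j); simpl; field; lra.
    + replace (- z ^ S m / ((1 - t) * D) * ((1 - p) / (1 - p * z)) ^ S m)
        with (- (z * ((1 - p) / (1 - p * z))) ^ S m / ((1 - t) * D))
        by (rewrite Rpow_mult_distr; unfold Rdiv; ring).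
      rewrite Hz1, S_INR; simpl; field; repeat split; lra.
Qed.

(** At each [t] the average of [integrand2] over Y_x equals that of [integrand_ln_fact] over Y_x -
    x: p E[Y_x] = E[Y_x - x] matches the linear terms, and the generating functions match by [Hw1].
    The averaged difference is thus the zero function. *)
Lemma negbinom_integrand2 (p : R) (m : nat) : 0 < p < 1 ->
  is_series (fun j => negbinom p m j *
     (RInt (integrand2 p (S (m + j))) 0 1 - ln (INR (fact j)))) 0.
Proof.
  intros Hp.
  assert (E : RInt (fun _ => 0) 0 1 = 0) by (rewrite RInt_const; apply Rmult_0_r).
  refine (eq_ind _ (is_series _) _ _ E).
  apply is_series_RInt with
    (F := fun j t => negbinom p m j *
            (integrand2 p (S (m + j)) t - integrand_ln_fact j t))
    (B := fun j => 4 * (INR (S (S (m + j))) * (INR (S (m + j)) * negbinom p m j))).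
  - lra.
  - intros j; apply (is_RInt_scal (V := R_NormedModule)).
    apply (is_RInt_minus (V := R_NormedModule)); [|apply is_RInt_ln_fact].
    apply (RInt_correct (V := R_CompleteNormedModule)).
    apply (integrable_bounded_integrand2 p (S (m + j)) Hp).
  - intros j t Ht; pose proof (negbinom_pos p m j Hp).
    rewrite Rabs_mult, (Rabs_pos_eq (negbinom p m j)) by lra.
    destruct (integrable_bounded_integrand2 p (S (m + j)) Hp) as [_ Hb].
    destruct (integrable_bounded_integrand_ln_fact j) as [_ Hb'].
    specialize (Hb t Ht); specialize (Hb' t Ht).
    replace (4 * (INR (S (S (m + j))) * (INR (S (m + j)) * negbinom p m j)))
      with (negbinom p m j * (4 * (INR (S (S (m + j))) * INR (S (m + j))))) by ring.
    apply Rmult_le_compat_l; [lra|].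
    unfold Rminus; apply Rle_trans with (1 := Rabs_triang _ _); rewrite Rabs_Ropp.
    assert (INR j + 1 <= INR (S (m + j))).
    { rewrite <- S_INR; apply le_INR; lia. }
    pose proof (pos_INR j); rewrite (S_INR (S (m + j))); nra.
  - apply (ex_series_scal (V := R_NormedModule)), negbinom_second_moment, Hp.
  - intros t Ht; pose proof (ln_1_sub_neg t Ht) as Hl.
    assert (Hpt : 0 < 1 + p * t) by nra.
    set (w := 1 / (1 + p * t)).
    assert (Hw : 0 <= w <= 1).
    { unfold w, Rdiv; rewrite Rmult_1_l.
      generalize (inv_1_add_bounds p t Hp); lra. }
    assert (Hw1 : w * ((1 - p) / (1 - p * w)) = (1 - p) / (1 - p * (1 - t))).
    { unfold w; field; repeat split; apply Rgt_not_eq; nra. }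
    set (D := t * ln (1 - t)).
    assert (HD : D <> 0) by (apply Rmult_integral_contrapositive_currified; lra).
    assert (S1 := is_series_lin _ (- t * INR (S m) / D) _ (negbinom_total p m Hp)).
    assert (S2 := is_series_lin _ (t * (1 - p) / D) _ (negbinom_mean p m Hp)).
    assert (S3 := is_series_lin _ (- w ^ S m / D) _ (negbinom_pgf p w m Hp Hw)).
    assert (S4 := is_series_lin _ (/ D) _ (negbinom_pgf p (1 - t) m Hp ltac:(lra))).
    assert (S' := is_series_add _ _ _ _ (is_series_add _ _ _ _ S1 S2)
                     (is_series_add _ _ _ _ S3 S4)).
    match type of S' with is_series _ ?l => replace 0 with l end.
    + eapply is_series_eq; [|exact S'].
      intros j; unfold integrand2, integrand_ln_fact; fold w D.
      replace (S (m + j)) with (S m + j)%nat by lia.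
      rewrite (pow_add w (S m) j), plus_INR; cbv beta; field; lra.
    + replace (- w ^ S m / D * ((1 - p) / (1 - p * w)) ^ S m)
        with (- (w * ((1 - p) / (1 - p * w))) ^ S m / D)
        by (rewrite Rpow_mult_distr; unfold Rdiv; ring).
      rewrite Hw1; field; repeat split; lra.
Qed.

(** * Growth of g *)

Lemma INR_S_pos (k : nat) : 0 < INR (S k).
Proof. apply lt_0_INR; lia. Qed.

Lemma ln_S_sub (k : nat) :
  (0 < k)%nat -> / INR (S k) <= ln (INR (S k)) - ln (INR k) <= / INR k.
Proof.
  intros Hk; assert (H0 : 0 < INR k) by (apply lt_0_INR; lia).
  pose proof (INR_S_pos k) as H1.
  assert (H2 : 0 < INR (S k) / INR k) by (apply Rdiv_lt_0_compat; lra).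
  rewrite <- ln_div by assumption; split.
  - pose proof (ln_ge_1_sub_inv _ H2) as H.
    replace (1 - / (INR (S k) / INR k)) with (/ INR (S k)) in H; [exact H|].
    rewrite S_INR in *; field; lra.
  - pose proof (ln_le_sub_1 _ H2) as H.
    replace (INR (S k) / INR k - 1) with (/ INR k) in H; [exact H|].
    rewrite S_INR in *; field; lra.
Qed.

Lemma ln_fact_S (k : nat) : ln (INR (fact (S k))) = ln (INR (S k)) + ln (INR (fact k)).
Proof.
  rewrite fact_simpl, mult_INR, ln_mult; [reflexivity|apply INR_S_pos|apply INR_fact_lt_0].
Qed.

(** A weak Stirling bound: the induction step amounts to n (ln (n + 1) - ln n) <= 1. *)
Lemma ln_fact_lower (n : nat) : INR n * ln (INR n) - INR n <= ln (INR (fact n)).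
Proof.
  induction n as [|n IH]; [simpl; rewrite ln_1; lra|].
  rewrite ln_fact_S; destruct n as [|n]; [simpl; rewrite ln_1; lra|].
  destruct (ln_S_sub (S n)) as [_ H]; [lia|].
  pose proof (INR_S_pos n) as H0; rewrite (S_INR (S n)) in *.
  assert (E : INR (S n) * / INR (S n) = 1) by (field; lra).
  assert (INR (S n) * (ln (INR (S n) + 1) - ln (INR (S n))) <= INR (S n) * / INR (S n))
    by (apply Rmult_le_compat_l; lra).
  lra.
Qed.

Lemma ln_fact_upper (k : nat) :
  ln (INR (fact k)) <= INR (S k) * ln (INR (S k)) - INR k.
Proof.
  induction k as [|k IH]; [simpl; rewrite ln_1; lra|].
  rewrite ln_fact_S; destruct (ln_S_sub (S k)) as [H _]; [lia|].
  pose proof (INR_S_pos (S k)) as H0.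
  assert (E : INR (S (S k)) * / INR (S (S k)) = 1) by (field; lra).
  assert (INR (S (S k)) * / INR (S (S k)) <=
          INR (S (S k)) * (ln (INR (S (S k))) - ln (INR (S k))))
    by (apply Rmult_le_compat_l; lra).
  rewrite (S_INR (S k)), (S_INR k) in *; lra.
Qed.

(** Passes from the integer part [n] to [a]: ln (a / n) <= a / n - 1 replaces n ln n by n ln a at
    cost a - n, and the remaining (a - n) ln a is at most [ln y]. The value [n = 0] is separate
    because a / n is then meaningless. *)
Lemma ln_fact_floor_lower (a y : R) (n : nat) :
  0 < a <= y -> 1 <= y -> INR n <= a < INR n + 1 ->
  a * ln a - a - ln y <= ln (INR (fact n)).
Proof.
  intros Ha Hy Hn; apply Rle_trans with (2 := ln_fact_lower n).
  assert (Hly : 0 <= ln y) by (rewrite <- ln_1; apply ln_le; lra).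
  assert (Hl : ln a <= ln y) by (apply ln_le; lra).
  assert (H1 : INR n * ln a - (a - INR n) <= INR n * ln (INR n)).
  { destruct n as [|n]; [simpl; lra|].
    pose proof (INR_S_pos n) as H0.
    assert (H2 : 0 < a / INR (S n)) by (apply Rdiv_lt_0_compat; lra).
    pose proof (ln_le_sub_1 _ H2) as H; rewrite ln_div in H by lra.
    assert (E : INR (S n) * (a / INR (S n) - 1) = a - INR (S n)) by (field; lra).
    assert (INR (S n) * (ln a - ln (INR (S n))) <= INR (S n) * (a / INR (S n) - 1))
      by (apply Rmult_le_compat_l; lra).
    lra. }
  assert ((a - INR n) * ln a <= ln y) by nra.
  lra.
Qed.

Lemma exp_mul_INR (x : R) (n : nat) : exp (INR n * x) = exp x ^ n.
Proof.
  induction n as [|n IH]; [simpl; rewrite Rmult_0_l; apply exp_0|].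
  rewrite S_INR, Rmult_plus_distr_r, exp_plus, IH, Rmult_1_l; simpl; ring.
Qed.

Lemma exp_nondecreasing (x y : R) : x <= y -> exp x <= exp y.
Proof.
  intros [H| ->]; [apply Rlt_le, exp_increasing, H|apply Rle_refl].
Qed.

Lemma exp_neg_add_le (x y : R) : 0 <= x <= y -> exp (- x) + x <= exp (- y) + y.
Proof.
  intros H; replace (- y) with (- x + - (y - x)) by ring; rewrite exp_plus.
  pose proof (exp_ineq1_le (- (y - x))); pose proof (exp_pos (- x)).
  assert (exp (- x) <= 1).
  { rewrite <- exp_0; apply exp_nondecreasing; lra. }
  nra.
Qed.

(* Both integrals compare with the one whose power is [exp (- p t y)], since
   [(1 - t)^n <= exp (- n t)] and [exp (- p t) <= 1 / (1 + p t)]. *)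
Lemma RInt_integrand2_lower (p : R) (y n : nat) :
  0 < p < 1 -> INR n <= p * INR y ->
  ln (INR (fact n)) <= RInt (integrand2 p y) 0 1.
Proof.
  intros Hp Hn.
  apply (is_RInt_le (integrand_ln_fact n) (integrand2 p y) 0 1);
    [lra|apply is_RInt_ln_fact| |].
  - apply (RInt_correct (V := R_CompleteNormedModule)).
    apply (integrable_bounded_integrand2 p y Hp).
  - intros t Ht; pose proof (ln_1_sub_neg t Ht).
    assert (H1 : (1 - t) ^ n <= exp (- (INR n * t))).
    { replace (- (INR n * t)) with (INR n * - t) by ring; rewrite exp_mul_INR.
      apply pow_incr; pose proof (exp_ineq1_le (- t)); lra. }
    assert (H2 : exp (- (INR n * t)) + INR n * t
                 <= exp (- (p * INR y * t)) + p * INR y * t).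
    { apply exp_neg_add_le; pose proof (pos_INR n); nra. }
    assert (H3 : exp (- (p * INR y * t)) <= (1 / (1 + p * t)) ^ y).
    { replace (- (p * INR y * t)) with (INR y * - (p * t)) by ring.
      rewrite exp_mul_INR; apply pow_incr; split; [apply Rlt_le, exp_pos|].
      rewrite exp_Ropp; unfold Rdiv; rewrite Rmult_1_l.
      apply Rinv_le_contravar; [nra|apply exp_ineq1_le]. }
    assert (HD : 0 < / (t * - ln (1 - t))).
    { apply Rinv_0_lt_compat, Rmult_lt_0_compat; lra. }
    unfold integrand_ln_fact, integrand2.
    (* Over the positive denominator [t * - ln (1 - t)] it is enough to compare numerators. *)
    replace ((1 - INR n * t - (1 - t) ^ n) / (t * ln (1 - t)))
      with (((1 - t) ^ n - 1 + INR n * t) * / (t * - ln (1 - t))) by (field; lra).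
    replace ((1 - t * INR y * p - (1 / (1 + p * t)) ^ y) / (t * ln (1 - t)))
      with (((1 / (1 + p * t)) ^ y - 1 + p * INR y * t) * / (t * - ln (1 - t)))
      by (field; repeat split; first [lra | nra]).
    apply Rmult_le_compat_r; lra.
Qed.

(** Supplies the O(1/k) error in the increments of the first integral. *)
Lemma is_RInt_pow_affine (p : R) (k : nat) : 0 < p < 1 ->
  is_RInt (fun t => (1 - (1 - p) * t) ^ k) 0 1
    ((1 - p ^ S k) / ((1 - p) * INR (S k))).
Proof.
  intros Hp; pose proof (INR_S_pos k) as Hk.
  pose (G := fun t => - (1 - (1 - p) * t) ^ S k / ((1 - p) * INR (S k))).
  replace ((1 - p ^ S k) / ((1 - p) * INR (S k))) with (G 1 - G 0).
  - apply (is_RInt_derive (V := R_CompleteNormedModule) G).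
    + intros t _; unfold G.
      apply is_derive_ext with
        (fun t => (- / ((1 - p) * INR (S k))) * (1 - (1 - p) * t) ^ S k).
      * intros u; apply Rmult_eq_reg_r with ((1 - p) * INR (S k));
          [field; lra|apply Rmult_integral_contrapositive_currified; lra].
      * evar_last.
        { apply is_derive_scal, (is_derive_pow (fun t => 1 - (1 - p) * t)).
          auto_derive; [exact I|reflexivity]. }
        change (Init.Nat.pred (S k)) with k; field; lra.
    + intros t _; apply (ex_derive_continuous (V := R_NormedModule)).
      auto_derive; exact I.
  - unfold G; replace (1 - (1 - p) * 1) with p by ring.
    replace (1 - (1 - p) * 0) with 1 by ring; rewrite pow1; field; lra.
Qed.

(* Concavity of [ln]: [(1 - t)^p <= 1 - p t]. *)
Lemma p_ln_1_sub_le (p t : R) : 0 < p < 1 -> 0 < t < 1 ->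
  p * ln (1 - t) <= ln (1 - p * t).
Proof.
  intros Hp Ht; assert (H0 : 0 < 1 - p * t) by nra.
  assert (H1 : 0 < (1 - t) / (1 - p * t)) by (apply Rdiv_lt_0_compat; lra).
  assert (H2 : 0 < / (1 - p * t)) by (apply Rinv_0_lt_compat; lra).
  pose proof (ln_le_sub_1 _ H1) as L1; rewrite ln_div in L1 by lra.
  pose proof (ln_le_sub_1 _ H2) as L2; rewrite ln_Rinv in L2 by lra.
  (* The two points have mean 1 under the weights [p] and [1 - p], so the tangent bounds at 1 add up
     to zero. *)
  assert (E : p * ((1 - t) / (1 - p * t) - 1) + (1 - p) * (/ (1 - p * t) - 1) = 0)
    by (field; lra).
  nra.
Qed.

(* With [z = (1 - t) / (1 - p t) <= (1 - t)^(1 - p)] and [s = 1 / (1 - p t)], the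
   difference of the integrands is [(1 - p) (1 - s^2 z^k) / (- ln (1 - t))], and
   [1 - s^2 z^k = (1 - z^(k+1)) - z^k (s^2 - z)]. *)
Lemma integrand1_increment_lower (p t : R) (k m : nat) :
  0 < p < 1 -> 0 < t < 1 -> INR m <= (1 - p) * INR (S k) ->
  (1 - p) * (((1 - t) ^ m - 1) / ln (1 - t)
             - 2 / (1 - p) ^ 2 * (1 - (1 - p) * t) ^ k)
  <= integrand1 p (S (S k)) t - integrand1 p (S k) t.
Proof.
  intros Hp Ht Hm.
  pose proof (ln_1_sub_neg t Ht) as Hl.
  pose proof (ln_le_sub_1 (1 - t) ltac:(lra)) as Hl2.
  assert (H0 : 0 < 1 - p * t) by nra.
  pose proof (inv_1_sub_bounds p t Hp ltac:(lra)) as Hs.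
  pose (s := / (1 - p * t)); pose (z := (1 - t) / (1 - p * t)).
  fold s in Hs.
  assert (Es : s * (1 - p * t) = 1) by (unfold s; field; lra).
  assert (Ez : z = 1 - (1 - p) * t * s) by (unfold z, s; field; lra).
  assert (Hz0 : 0 < z) by (unfold z; apply Rdiv_lt_0_compat; lra).
  assert (Hz1 : z <= 1 - (1 - p) * t).
  { rewrite Ez; assert (0 < (1 - p) * t) by nra; nra. }
  assert (Hzk : z ^ k <= (1 - (1 - p) * t) ^ k) by (apply pow_incr; lra).
  (* Since [ln (1 - t)] is negative, lowering the exponent from (1 - p)(k + 1) to [m] raises the
     power. *)
  assert (Hzm : z ^ S k <= (1 - t) ^ m).
  { rewrite <- (exp_ln z), <- (exp_ln (1 - t)), <- !exp_mul_INR by lra.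
    apply exp_nondecreasing; unfold z; rewrite ln_div by lra.
    pose proof (p_ln_1_sub_le p t Hp Ht); pose proof (INR_S_pos k).
    apply Rle_trans with (INR (S k) * ((1 - p) * ln (1 - t))).
    - apply Rmult_le_compat_l; lra.
    - nra. }
  (* The factor [t] will absorb the denominator, as [t <= - ln (1 - t)]. *)
  assert (Hsz : s ^ 2 - z <= 2 / (1 - p) ^ 2 * t).
  { replace (s ^ 2 - z) with ((1 + p - p * t) * t * s ^ 2)
      by (unfold s, z; field; lra).
    assert (s ^ 2 <= (/ (1 - p)) ^ 2) by (apply pow_incr; lra).
    unfold Rdiv; rewrite <- pow_inv.
    assert (0 <= s ^ 2) by (apply pow_le; lra).
    assert (0 <= (1 + p - p * t) * t <= 2 * t) by nra.
    apply Rle_trans with (2 * t * s ^ 2); nra. }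
  assert (HC : 0 < 2 / (1 - p) ^ 2) by (apply Rdiv_lt_0_compat; [lra|apply pow_lt; lra]).
  replace (integrand1 p (S (S k)) t - integrand1 p (S k) t)
    with ((1 - p) * ((1 - s ^ 2 * z ^ k) / - ln (1 - t))).
  2: { unfold integrand1; rewrite (S_INR (S k)); unfold s, z; simpl; field.
       repeat split; lra. }
  apply Rmult_le_compat_l; [lra|].
  replace (((1 - t) ^ m - 1) / ln (1 - t)) with ((1 - (1 - t) ^ m) / - ln (1 - t))
    by (field; lra).
  apply Rmult_le_reg_r with (- ln (1 - t)); [lra|].
  unfold Rdiv at 3; rewrite Rmult_assoc, Rinv_l, Rmult_1_r by lra.
  rewrite Rmult_minus_distr_r.
  unfold Rdiv at 1; rewrite Rmult_assoc, Rinv_l, Rmult_1_r by lra.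
  replace (1 - s ^ 2 * z ^ k) with ((1 - z ^ S k) - z ^ k * (s ^ 2 - z)) by (simpl; ring).
  assert (0 < z ^ k) by (apply pow_lt; lra).
  assert (B1 : z ^ k * (s ^ 2 - z) <= z ^ k * (2 / (1 - p) ^ 2 * t))
    by (apply Rmult_le_compat_l; lra).
  assert (B2 : z ^ k * (2 / (1 - p) ^ 2 * t)
               <= (1 - (1 - p) * t) ^ k * (2 / (1 - p) ^ 2 * - ln (1 - t))).
  { apply Rmult_le_compat; [lra|apply Rmult_le_pos; lra|lra|].
    apply Rmult_le_compat_l; lra. }
  lra.
Qed.

(** Integrates the pointwise bound with [m] the integer part of (1 - p)(k + 1), so that [INR (S m)]
    exceeds that number; the positive term in [p ^ S k] is dropped. *)
Lemma RInt_integrand1_increment (p : R) (k : nat) : 0 < p < 1 ->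
  (1 - p) * ln ((1 - p) * INR (S k)) - 2 / (1 - p) ^ 2 / INR (S k)
  <= RInt (integrand1 p (S (S k))) 0 1 - RInt (integrand1 p (S k)) 0 1.
Proof.
  intros Hp; pose proof (INR_S_pos k) as Hk.
  assert (HC : 0 < 2 / (1 - p) ^ 2) by (apply Rdiv_lt_0_compat; [lra|apply pow_lt; lra]).
  destruct (nfloor_ex ((1 - p) * INR (S k))) as [m Hm]; [nra|].
  assert (HI := is_RInt_minus (V := R_NormedModule) _ _ _ _ _ _
    (RInt_correct (V := R_CompleteNormedModule) _ _ _
       (proj1 (integrable_bounded_integrand1 p (S k) Hp)))
    (RInt_correct (V := R_CompleteNormedModule) _ _ _
       (proj1 (integrable_bounded_integrand1 p k Hp)))).
  assert (HL := is_RInt_scal (V := R_NormedModule) _ _ _ (1 - p) _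
    (is_RInt_minus (V := R_NormedModule) _ _ _ _ _ _ (is_RInt_ln_S m)
       (is_RInt_scal (V := R_NormedModule) _ _ _ (2 / (1 - p) ^ 2) _
          (is_RInt_pow_affine p k Hp)))).
  assert (H := is_RInt_le _ _ 0 1 _ _ Rle_0_1 HL HI
    (fun t Ht => integrand1_increment_lower p t k m Hp Ht (proj1 Hm))).
  refine (Rle_trans _ _ _ _ H).
  change ((1 - p) * ln ((1 - p) * INR (S k)) - 2 / (1 - p) ^ 2 / INR (S k)
    <= (1 - p) * (ln (INR (S m)) -
         2 / (1 - p) ^ 2 * ((1 - p ^ S k) / ((1 - p) * INR (S k))))).
  assert (L : ln ((1 - p) * INR (S k)) <= ln (INR (S m))).
  { apply ln_le; [apply Rmult_lt_0_compat; lra|rewrite (S_INR m); lra]. }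
  replace ((1 - p) * (ln (INR (S m)) -
         2 / (1 - p) ^ 2 * ((1 - p ^ S k) / ((1 - p) * INR (S k)))))
    with ((1 - p) * ln (INR (S m)) - 2 / (1 - p) ^ 2 / INR (S k)
          + p ^ S k * (2 / (1 - p) ^ 2 / INR (S k))) by (field; lra).
  assert (0 <= p ^ S k * (2 / (1 - p) ^ 2 / INR (S k))).
  { apply Rmult_le_pos; [apply pow_le; lra|].
    apply Rlt_le, Rdiv_lt_0_compat; lra. }
  nra.
Qed.

(** Telescoping: the main terms sum to the factorial, and the harmonic errors are absorbed by
    increments of the logarithm. *)
Lemma RInt_integrand1_lower (p : R) (k : nat) : 0 < p < 1 ->
  RInt (integrand1 p 1) 0 1 + (1 - p) * (INR k * ln (1 - p) + ln (INR (fact k)))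
    - 4 / (1 - p) ^ 2 * ln (INR (S k))
  <= RInt (integrand1 p (S k)) 0 1.
Proof.
  intros Hp; induction k as [|k IH]; [simpl; rewrite ln_1; lra|].
  pose proof (RInt_integrand1_increment p k Hp) as H.
  pose proof (INR_S_pos k) as Hk.
  destruct (ln_S_sub (S k)) as [HS _]; [lia|].
  rewrite ln_mult in H by lra; rewrite ln_fact_S.
  assert (HC : 0 < 2 / (1 - p) ^ 2) by (apply Rdiv_lt_0_compat; [lra|apply pow_lt; lra]).
  (* The constant doubles from 2 to 4 because 1 / (k + 1) <= 2 / (k + 2), while only 1 / (k + 2)
     lies below the logarithmic increment. *)
  assert (E : 2 / (1 - p) ^ 2 / INR (S k) <=
     4 / (1 - p) ^ 2 * (ln (INR (S (S k))) - ln (INR (S k)))).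
  { replace (4 / (1 - p) ^ 2) with (2 / (1 - p) ^ 2 * 2) by (field; lra).
    unfold Rdiv at 1; rewrite Rmult_assoc; apply Rmult_le_compat_l; [lra|].
    apply Rle_trans with (2 * / INR (S (S k))); [|lra].
    assert (HH : 2 * / INR (S (S k)) - / INR (S k) =
      (INR (S k) - 1) * (/ INR (S (S k)) * / INR (S k))).
    { rewrite (S_INR (S k)); field; lra. }
    assert (1 <= INR (S k)) by (rewrite S_INR; generalize (pos_INR k); lra).
    assert (0 < / INR (S (S k)) * / INR (S k)).
    { apply Rmult_lt_0_compat; apply Rinv_0_lt_compat; [apply INR_S_pos|lra]. }
    nra. }
  rewrite (S_INR k) at 1; lra.
Qed.

(** With y = k + 1, the first integral leaves p ln k! of the factorial, and its p y ln y cancels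
    against the second integral. What remains linear in y is at most y h(p); the constant 1 covers p
    y - p k = p. *)
Lemma g_upper (p : R) (k : nat) : 0 < p < 1 ->
  g p (S k) - INR (S k) * h p
  <= 1 - RInt (integrand1 p 1) 0 1 + (4 / (1 - p) ^ 2 + 1) * ln (INR (S k)).
Proof.
  intros Hp; pose proof (INR_S_pos k) as Hk.
  assert (E : g p (S k) = ln (INR (fact k)) - RInt (integrand1 p (S k)) 0 1
                          - RInt (integrand2 p (S k)) 0 1).
  { unfold g; replace (S k - 1)%nat with k by lia; reflexivity. }
  assert (Hy : 1 <= INR (S k)) by (rewrite S_INR; generalize (pos_INR k); lra).
  destruct (nfloor_ex (p * INR (S k))) as [n Hn]; [nra|].
  pose proof (RInt_integrand1_lower p k Hp) as H1.
  pose proof (RInt_integrand2_lower p (S k) n Hp (proj1 Hn)) as H2.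
  pose proof (ln_fact_floor_lower (p * INR (S k)) (INR (S k)) n
                ltac:(nra) Hy Hn) as H3.
  rewrite ln_mult in H3 by lra.
  pose proof (ln_fact_upper k) as H4.
  assert (H5 : ln (1 - p) <= 0) by (generalize (ln_neg (1 - p)); lra).
  assert (H6 : p * ln (INR (fact k)) <= p * (INR (S k) * ln (INR (S k)) - INR k))
    by (apply Rmult_le_compat_l; lra).
  rewrite E; unfold h; rewrite (S_INR k) in *; nra.
Qed.

Lemma weight_pos (p q : R) (y : nat) : 0 < q -> 0 < weight p q y.
Proof.
  intros Hq; apply Rmult_lt_0_compat; [apply pow_lt, Hq|apply exp_pos].
Qed.

Lemma ex_series_weight (p q : R) : 0 < p < 1 -> 0 < q < 1 ->
  ex_series (fun k => weight p q (S k)).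
Proof.
  intros Hp Hq; set (K := 1 - RInt (integrand1 p 1) 0 1).
  assert (HC : 0 < 4 / (1 - p) ^ 2) by (apply Rdiv_lt_0_compat; [lra|apply pow_lt; lra]).
  (* The exponent [S N] exceeds the coefficient of the logarithm in [g_upper], so the weights are at
     most a constant times [INR (S k) ^ S N * q ^ k]. *)
  destruct (nfloor_ex (4 / (1 - p) ^ 2 + 1)) as [N HN]; [lra|].
  apply (ex_series_le (K := R_AbsRing) (V := R_CompleteNormedModule)) with
    (fun k => (exp K * q) * (INR (S k) ^ S N * q ^ k)).
  - intros k; change (norm (weight p q (S k))) with (Rabs (weight p q (S k))).
    pose proof (weight_pos p q (S k) (proj1 Hq)).
    rewrite Rabs_pos_eq by lra; unfold weight.
    pose proof (INR_S_pos k) as Hk.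
    assert (Hy : 1 <= INR (S k)) by (rewrite S_INR; generalize (pos_INR k); lra).
    assert (Hly : 0 <= ln (INR (S k))) by (rewrite <- ln_1; apply ln_le; lra).
    assert (He : exp (g p (S k) - INR (S k) * h p) <= exp K * INR (S k) ^ S N).
    { rewrite <- (exp_ln (INR (S k))) at 2 by lra.
      rewrite <- exp_mul_INR, <- exp_plus; apply exp_nondecreasing.
      pose proof (g_upper p k Hp) as Hg; fold K in Hg.
      apply Rle_trans with (1 := Hg), Rplus_le_compat_l, Rmult_le_compat_r; [lra|].
      rewrite (S_INR N); lra. }
    pose proof (pow_lt q (S k) (proj1 Hq)).
    apply Rle_trans with (q ^ S k * (exp K * INR (S k) ^ S N)).
    + apply Rmult_le_compat_l; lra.
    + simpl (q ^ S k); apply Req_le; ring.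
  - apply (ex_series_scal (V := R_NormedModule)), ex_series_INR_pow, Hq.
Qed.

(** * The divergence *)

(** Taking the series as its own majorant, the tail bound at index 0 makes [l - a 0] nonnegative. *)
Lemma series_pos (a : nat -> R) (l : R) :
  (forall k, 0 < a k) -> is_series a l -> 0 < l.
Proof.
  intros Ha Hl.
  assert (H := is_series_tail_le a a l l 0%nat
    (fun k => Req_le _ _ (Rabs_pos_eq _ (Rlt_le _ _ (Ha k)))) Hl Hl).
  rewrite !sum_O in H; pose proof (Rabs_pos (l - a 0%nat)); specialize (Ha 0%nat); lra.
Qed.

Lemma expectation_Ydist (p : R) (m : nat) : 0 < p < 1 ->
  expectation (Ydist p (S m)) = INR (S m) / (1 - p).
Proof.
  intros Hp; apply is_series_unique.
  apply (is_series_zero_prefix _ m).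
  - intros k Hk; rewrite Ydist_lt by lia; ring.
  - eapply is_series_eq; [|apply negbinom_mean, Hp].
    intros j; cbv beta; rewrite Ydist_negbinom; reflexivity.
Qed.

(** The ln (y - 1)! of the binomial coefficient cancels the one in [g]. The rest is affine in y plus
    the two integrals, with ln j! attached to the second so that [negbinom_integrand2] applies. *)
Lemma KL_term_negbinom (p q : R) (m j : nat) :
  0 < p < 1 -> 0 < q < 1 -> 0 < y0 p q ->
  KL_term (Ydist p (S m)) (Yq p q) (S (m + j)) =
    (- ln (INR (fact m)) - ln (y0 p q) + INR (S m) * (ln (1 - p) - ln p))
      * negbinom p m j
    + (ln p + h p - ln q) * (INR (S (m + j)) * negbinom p m j)
    + (negbinom p m j * RInt (integrand1 p (S (m + j))) 0 1
       + negbinom p m j * (RInt (integrand2 p (S (m + j))) 0 1 - ln (INR (fact j)))).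
Proof.
  intros Hp Hq H0.
  assert (Hw := weight_pos p q (S (m + j)) (proj1 Hq)).
  assert (Hn := negbinom_pos p m j Hp).
  unfold KL_term; rewrite Ydist_negbinom; unfold Yq.
  rewrite ln_div; [|exact Hn|apply Rmult_lt_0_compat; assumption].
  rewrite (ln_mult (y0 p q)) by assumption.
  assert (E1 : ln (weight p q (S (m + j))) = INR (S (m + j)) * ln q
     + (ln (INR (fact (m + j))) - RInt (integrand1 p (S (m + j))) 0 1
        - RInt (integrand2 p (S (m + j))) 0 1 - INR (S (m + j)) * h p)).
  { unfold weight; rewrite ln_mult, ln_pow, ln_exp;
      [|lra|apply pow_lt; lra|apply exp_pos].
    unfold g; replace (S (m + j) - 1)%nat with (m + j)%nat by lia; reflexivity. }
  assert (E2 : ln (negbinom p m j) = ln (INR (fact (m + j))) - ln (INR (fact m))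
     - ln (INR (fact j)) + INR (S m) * ln (1 - p) + INR j * ln p).
  { assert (P1 : 0 < (1 - p) ^ S m) by (apply pow_lt; lra).
    assert (P2 : 0 < p ^ j) by (apply pow_lt; lra).
    pose proof (C_pos (m + j) m) as P3.
    unfold negbinom; rewrite ln_mult, ln_mult, !ln_pow;
      [|lra|lra|exact P3|exact P1|apply Rmult_lt_0_compat; assumption|exact P2].
    unfold Binomial.C; replace (m + j - m)%nat with j by lia.
    pose proof (INR_fact_lt_0 m); pose proof (INR_fact_lt_0 j).
    pose proof (INR_fact_lt_0 (m + j)).
    rewrite ln_div, ln_mult; [ring|assumption|assumption|assumption|].
    apply Rmult_lt_0_compat; assumption. }
  rewrite E1, E2.
  replace (INR (S (m + j))) with (INR (S m) + INR j)
    by (rewrite <- plus_INR; f_equal).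
  ring.
Qed.

Lemma is_series_KL_term (p q : R) (m : nat) :
  0 < p < 1 -> 0 < q < 1 -> 0 < y0 p q ->
  is_series (fun k => KL_term (Ydist p (S m)) (Yq p q) (S k))
    (- ln (y0 p q) - expectation (Ydist p (S m)) * ln q).
Proof.
  intros Hp Hq H0; apply (is_series_zero_prefix _ m).
  - intros k Hk; unfold KL_term; rewrite Ydist_lt by lia; ring.
  - rewrite expectation_Ydist by exact Hp.
    pose (c := - ln (INR (fact m)) - ln (y0 p q) + INR (S m) * (ln (1 - p) - ln p)).
    assert (HS := is_series_add _ _ _ _
      (is_series_add _ _ _ _
        (is_series_lin _ c _ (negbinom_total p m Hp))
        (is_series_lin _ (ln p + h p - ln q) _ (negbinom_mean p m Hp)))
      (is_series_add _ _ _ _ (negbinom_integrand1 p m Hp) (negbinom_integrand2 p m Hp))).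
    match type of HS with is_series _ ?l =>
      replace (- ln (y0 p q) - INR (S m) / (1 - p) * ln q) with l end.
    + eapply is_series_eq; [|exact HS].
      intros j; symmetry; apply KL_term_negbinom; assumption.
    (* The ln m! from the first integral cancels that in [c], and (ln p + h p) / (1 - p) = ln p - ln
       (1 - p) cancels the remaining terms in [p]. *)
    + unfold c, h; field; lra.
Qed.

Theorem mainTheorem5 (p q : R) (hp : 0 < p < 1) (hq : 0 < q < 1) :
  ex_series (fun k => weight p q (S k)) /\
  is_distribution (Yq p q) /\
  (forall x : nat, (1 <= x)%nat ->
     KL (Ydist p x) (Yq p q)
     = Finite (- ln (y0 p q) - expectation (Ydist p x) * ln q)).
Proof.
  assert (Hex := ex_series_weight p q hp hq).
  assert (HS := Series_correct _ Hex).
  assert (Hpos := series_pos _ _ (fun k => weight_pos p q (S k) (proj1 hq)) HS).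
  assert (H0 : 0 < y0 p q) by (apply Rinv_0_lt_compat; exact Hpos).
  assert (HY : forall y, 0 < Yq p q y).
  { intros y; apply Rmult_lt_0_compat; [exact H0|apply weight_pos, hq]. }
  split; [exact Hex|split; [split|]].
  - intros y _; apply Rlt_le, HY.
  - replace 1 with (y0 p q * Series (fun k => weight p q (S k)))
      by (unfold y0; field; lra).
    apply is_series_lin, HS.
  - intros [|m] Hx; [lia|].
    assert (HK := is_series_KL_term p q m hp hq H0).
    unfold KL; destruct (excluded_middle_informative _) as [_|Hn].
    + f_equal; apply is_series_unique, HK.
    (* The infinite branch is impossible: [Yq] is strictly positive, so absolute continuity is
       vacuous, and the series converges. *)
    + destruct Hn; split.
      * intros y _ Hy; specialize (HY y); lra.
      * eexists; exact HK.
Qed.
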